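(* Let $B$ be a bicyclic graph on $n$ vertices. Then ${\rm pind}(B_{B})\leq 2$, where $B_B$ denotes the matrix $B_G$ for $G=B$. Hence $B$ is $(1,3)$-choosable.
   Context: Graphs are finite and simple. A bicyclic graph is a connected graph with $n$ vertices and $n+1$ edges for some $n$ (such a graph contains two or three cycles). The permanent of an $m\times m$ real matrix $A=[a_{ij}]$ is ${\rm per}(A)=\sum_{\sigma}\prod_{i=1}^{m}a_{i\sigma(i)}$, summed over all permutations $\sigma$ of $\{1,\ldots,m\}$. The permanent index ${\rm pind}(A)$ of a matrix $A$ with $m$ rows is the minimum integer $k$ such that there is an $m\times m$ matrix $A'$ with ${\rm per}(A')\neq 0$, each column of which is a column of $A$, and such that each column of $A$ occurs in $A'$ at most $k$ times. For a graph $G$, fix an orientation of its edges. $B_G$ is the matrix with rows and columns both indexed by the edges of $G$, where for $e=(u,v)$ (oriented from $u$ to $v$) and an edge $y$, $B_G[e,y]=1$ if $y\neq e$ is incident to $v$; $B_G[e,y]=-1$ if $y\neq e$ is incident to $u$; and $B_G[e,y]=0$ otherwise (an edge $y\neq e$ cannot be incident to both ends of $e$ in a simple graph). (Reversing an edge multiplies the corresponding row by $-1$, so ${\rm pind}(B_G)$ does not depend on the orientation.) A total-weighting of $G=(V,E)$ is a mapping $f:V\cup E\to\mathbb{R}$. For $v\in V$ put $s(v)=f(v)+\sum_{e\in E(v)}f(e)$, where $E(v)$ is the set of edges incident with $v$. The total-weighting $f$ is proper if $s(u)\neq s(v)$ for any two adjacent vertices $u,v$. The graph $G$ is $(k,k')$-choosable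 if for every assignment $L$ of a set $L(v)$ of $k$ real numbers to each vertex $v$ and a set $L(e)$ of $k'$ real numbers to each edge $e$, there is a proper total-weighting $f$ with $f(z)\in L(z)$ for all $z\in V\cup E$. *)

(* Defs.v *)
From HB Require Import structures.
From mathcomp Require Import all_boot all_order all_fingroup all_algebra finmap.
From mathcomp Require Import boolp reals.

Set Implicit Arguments.
Unset Strict Implicit.
Unset Printing Implicit Defensive.

Import GRing.Theory.
Local Open Scope ring_scope.

Record sgraph := SGraph {
  vertex :> finType;
  adj : rel vertex;
  adj_sym : symmetric adj;
  adj_irrefl : irreflexive adj }.

Definition edge_set (G : sgraph) : {set {set G}} :=
  [set E : {set G} | [exists u, exists v, adj u v && (E == [set u; v])]].

Definition edge (G : sgraph) := {E : {set G} | E \in edge_set G}.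

(* The graph with no vertices is also connected in this sense; it is excluded
   from [bicyclic] by the edge count. *)
Definition graph_connected (G : sgraph) : Prop :=
  forall u v : G, connect (@adj G) u v.

Definition bicyclic (G : sgraph) : Prop :=
  graph_connected G /\ #|edge_set G| = #|G|.+1.

Definition permanent (R : comNzRingType) (m : nat) (A : 'M[R]_m) : R :=
  \sum_(s : 'S_m) \prod_(i < m) A i (s i).

(* The columns of [A'] are chosen by position: column [j] of [A'] is column
   [c j] of [A], and multiplicities are counted for column positions of [A]. *)
Definition pind_admissible (R : comNzRingType) (m n : nat) (A : 'M[R]_(m, n))
    (k : nat) : bool :=
  [exists c : {ffun 'I_m -> 'I_n},
     (permanent (colsub c A) != 0) &&
     [forall j : 'I_n, (#|[set i | c i == j]| <= k)%N]].

(* [None] when no [k] is admissible, i.e. when the index is infinite. *)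
Definition pind (R : comNzRingType) (m n : nat) (A : 'M[R]_(m, n)) :
    option nat :=
  if pselect (exists k, pind_admissible A k) is left h
  then Some (ex_minn h) else None.

(* [o e = (u, v)] orients the edge [e] from [u] to [v]. *)
Definition is_orientation (G : sgraph) (o : edge G -> G * G) : Prop :=
  forall e : edge G, val e = [set (o e).1; (o e).2].

Definition edge_entry (R : comNzRingType) (G : sgraph) (o : edge G -> G * G)
    (e y : edge G) : R :=
  if y == e then 0
  else if (o e).2 \in val y then 1
  else if (o e).1 \in val y then -1
  else 0.

Definition edge_matrix (R : comNzRingType) (G : sgraph)
    (o : edge G -> G * G) : 'M[R]_#|{: edge G}| :=
  \matrix_(i, j) edge_entry R o (enum_val i) (enum_val j).

Definition vertex_sum (R : realType) (G : sgraph) (f : G + edge G -> R)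
    (v : G) : R :=
  f (inl v) + \sum_(e : edge G | v \in val e) f (inr e).

Definition proper_weighting (R : realType) (G : sgraph)
    (f : G + edge G -> R) : Prop :=
  forall u v : G, adj u v -> vertex_sum f u <> vertex_sum f v.

Definition choosable (R : realType) (G : sgraph) (k k' : nat) : Prop :=
  forall L : G + edge G -> {fset R},
    (forall v : G, #|` L (inl v)| = k) ->
    (forall e : edge G, #|` L (inr e)| = k') ->
    exists2 f : G + edge G -> R,
      proper_weighting f & forall z, f z \in L z.

(* Main.v *)
Require Import Defs.
From mathcomp Require Import all_boot all_order all_fingroup all_algebra finmap.
From mathcomp Require Import boolp reals.
From mathcomp Require Import zify.

(** Give every vertex v a variable s_v and let Q be the product of the linear
    forms s_v - s_u, one for each oriented edge (u, v). The column of an edge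
    xy of B_G lists the values on these forms of the derivation D_xy = d_x + d_y,
    where d_x is the derivative in s_x: the value is 0 on the edge xy itself, and
    1 or -1 on an edge that shares exactly one end with xy. Applying as many
    such derivations as there are edges to Q therefore yields the permanent of
    the matrix of the chosen columns, and pind(B_G) <= 2 says that some product
    of the D_e, in which no D_e occurs more than twice, does not annihilate Q.

    This is proved for all induced subgraphs at once, by deleting vertices. The
    only obstruction is a component K_2, on which D_e kills the only factor. The
    hypothesis that survives the deletions is that every vertex set X spans at
    most |X| + 1 edges; it holds in a connected graph with n vertices and n + 1
    edges because a vertex set can be grown one vertex at a time, each time
    gaining an edge. Three deletions suffice.

    - Let f = pq be an edge that meets one or two other edges. D_f kills f, so
      the power of D_f with that exponent uses up exactly the factors of the
      edges that meet f. The factor of f is then used up by any edge g that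
      meets f, since no edge of G - p - q does (pind_le2_del_edge). If G - p - q
      has a new component K_2, with edge h, and deg p + deg q is minimal, then
      all edges that meet f run from f to h; the square of D_g uses up the
      factors of f and h, and all four vertices go (pind_le2_del_edge2).
    - Let a and b have the same neighbourhood, of size d. Then D_az - D_bz is
      d_a - d_b for each of the d neighbours z, so the power of d_a - d_b with
      exponent 2d is available; it uses up exactly the 2d factors that involve
      a or b (pind_le2_del_twins). Expanding this power shows that one of the
      products of D_az's and D_bz's is nonzero (per_on_choice).
    - A component K_4 minus an edge is removed by an explicit product
      (pind_le2_del_diamond).

    If deg p + deg q >= 5 for all edges pq, the vertices of degree at least 2
    span a subgraph whose degrees exceed 2 by at most 2 in total, and this
    forces twins of degree at most 2 (exists_twins).

    For choosability, the permanent is a multiple of the coefficient of a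
    monomial with exponents at most 2 in the product of the differences of the
    vertex sums, viewed as a polynomial in the edge weights, and the
    Combinatorial Nullstellensatz applies (nullstellensatz). *)

Set Implicit Arguments.
Unset Strict Implicit.
Unset Printing Implicit Defensive.

Import Order.TTheory GRing.Theory Num.Theory.
Local Open Scope ring_scope.

(** * Permanents on a set of rows *)
Lemma all2_choice_count (T : eqType) (zs : seq T) (ps : seq (T * T)) e :
  all2 (fun z p => (z == p.1) || (z == p.2)) zs ps ->
  (count_mem e zs <= count (fun p => (e == p.1) || (e == p.2)) ps)%N.
Proof.
elim: zs ps => [|z zs IH] [|p ps] //= /andP[zp /IH le].
by rewrite leq_add //; have [<-|//] := eqVneq z e; rewrite zp.
Qed.

Section PermanentOn.
Variables (R : numFieldType) (E : finType).
Implicit Types (c d : {ffun E -> R}) (cs ds : seq {ffun E -> R}) (F I : {set E}).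

(** The permanent of the columns [cs] on the rows [F], by Laplace expansion
    along the first column. A column acts as a derivation on the product of the
    rows, which is why rows are an unordered set that shrinks. *)
Fixpoint per_on cs F : R :=
  if cs is c :: cs' then \sum_(r in F) c r * per_on cs' (F :\ r)
  else (F == set0)%:R.

Lemma per_on_size cs F : per_on cs F != 0 -> size cs = #|F|.
Proof.
elim: cs F => [|c cs IH] F /=.
  by have [->|_] := eqVneq F set0; rewrite ?cards0 ?eqxx.
move=> nz; have [/existsP[r /andP[rF nzr]]|] :=
  boolP [exists r in F, c r * per_on cs (F :\ r) != 0].
  rewrite (cardsD1 r F) rF; congr _.+1; apply: IH.
  by apply: contraNneq nzr => ->; rewrite mulr0.
rewrite negb_exists_in => /forall_inP zr; case/eqP: nz.
by apply: big1 => r rF; apply/eqP; rewrite -[_ == _]negbK zr.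
Qed.

(** No column is able to use up the row [r]. *)
Lemma per_on_row0 cs F r :
  r \in F -> {in cs, forall c, c r = 0} -> per_on cs F = 0.
Proof.
elim: cs F => [|c cs IH] F rF cs0 /=.
  by have [F0|//] := eqVneq F set0; rewrite F0 inE in rF.
apply: big1 => s sF; have [<-|ne] := eqVneq r s.
  by rewrite cs0 ?mem_head // mul0r.
by rewrite IH ?mulr0 ?in_setD1 ?ne // => c' c'in; rewrite cs0 // inE c'in orbT.
Qed.

(** If only the first column can use up the row [r], it has to do so. *)
Lemma per_on_row1 c cs F r : r \notin F -> {in cs, forall c', c' r = 0} ->
  per_on (c :: cs) (r |: F) = c r * per_on cs F.
Proof.
move=> rF cs0; rewrite /= big_setU1 //= setU1K // big1 ?addr0 // => s sF.
have ne : r != s by apply: contraNneq rF => ->.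
by rewrite (@per_on_row0 _ _ r) ?mulr0 // !inE ne eqxx.
Qed.

(** Proportional columns supported on exactly as many rows as there are columns
    must use up these rows. All assignments of the columns [cs] to the rows [I]
    contribute the same value, hence nothing cancels in characteristic 0. *)
Lemma per_on_block d cs ds I F :
  size cs = #|I| ->
  {in I, forall r, d r != 0} -> {in F, forall r, d r = 0} ->
  {in cs, forall c, exists2 k : R, k != 0 & {in I :|: F, forall r, c r = k * d r}} ->
  per_on ds F != 0 -> per_on (cs ++ ds) (I :|: F) != 0.
Proof.
move=> szI dI dF csd dsF.
have dIF : [disjoint I & F].
  rewrite disjoints_subset; apply/subsetP => r rI; rewrite in_setC.
  by apply: contra (dI r rI) => rF; rewrite dF.
suff [k nzk ->] : exists2 k : R, k != 0 &
    per_on (cs ++ ds) (I :|: F) = k * (\prod_(r in I) d r) * per_on ds F.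
  by rewrite !mulf_neq0 //; apply/prodf_neq0.
(* The rows left over after some columns are spent form a subset J of I; the
   constant k depends only on the columns that remain. *)
suff [k nzk kP] : exists2 k : R, k != 0 & forall J : {set E}, J \subset I ->
    #|J| = size cs ->
    per_on (cs ++ ds) (J :|: F) = k * (\prod_(r in J) d r) * per_on ds F.
  by exists k => //; apply: kP.
elim: cs csd {szI} => [|c cs IH] csd.
  exists 1; rewrite ?oner_neq0 // => J _ /eqP; rewrite cards_eq0 => /eqP ->.
  by rewrite set0U big_set0 !mul1r.
have [k0 nz0 cE] := csd c (mem_head _ _).
have [c' c'in|k nzk kP] := IH; first by apply: csd; rewrite inE c'in orbT.
exists ((size cs).+1%:R * k0 * k) => [|J JI szJ].
  by rewrite !mulf_neq0 // pnatr_eq0.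
have dJF : [disjoint J & F] by apply: disjointWl JI dIF.
rewrite [_ ++ _]/= /per_on -/per_on (big_setID J) /=.
rewrite [X in _ + X]big1 ?addr0; last first.
  move=> r; rewrite !inE => /andP[/negPf rJ]; rewrite rJ /= => rF.
  by rewrite cE ?dF ?mulr0 ?mul0r // inE rF orbT.
have -> : (J :|: F) :&: J = J by rewrite setUK.
rewrite (eq_bigr (fun=> k0 * k * (\prod_(r in J) d r) * per_on ds F)); last first.
  move=> r rJ; rewrite cE ?inE ?(subsetP JI) //.
  have -> : (J :|: F) :\ r = (J :\ r) :|: F.
    apply/setP => s; rewrite !inE; case: eqP => //= ->.
    by rewrite (disjointFr dJF).
  rewrite kP; last 2 first.
  - by apply: subset_trans JI; rewrite subD1set.
  - by move: szJ; rewrite (cardsD1 r) rJ => -[].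
  by rewrite (big_setD1 r rJ) /= !mulrA [k0 * d r * k]mulrAC.
have sum_const (x : R) : \sum_(r in J) x = #|J|%:R * x by rewrite sumr_const mulr_natl.
by rewrite [LHS]sum_const szJ !mulrA.
Qed.

Lemma per_on_sub cs c c' ds F :
  per_on (cs ++ (c - c') :: ds) F =
  per_on (cs ++ c :: ds) F - per_on (cs ++ c' :: ds) F.
Proof.
elim: cs F => [|c0 cs IH] F /=.
  by rewrite -sumrB; apply: eq_bigr => r _; rewrite !ffunE mulrBl.
by rewrite -sumrB; apply: eq_bigr => r _; rewrite IH mulrBr.
Qed.

(** By multilinearity, a nonzero permanent of differences of columns expands into
    permanents of choices from the pairs, one of which is nonzero. *)
Lemma per_on_choice (J : eqType) (col : J -> {ffun E -> R}) (ps : seq (J * J)) ds F :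
  per_on ([seq col p.1 - col p.2 | p <- ps] ++ ds) F != 0 ->
  exists2 zs, all2 (fun z p => (z == p.1) || (z == p.2)) zs ps &
    per_on ([seq col z | z <- zs] ++ ds) F != 0.
Proof.
suff H cs : per_on (cs ++ [seq col p.1 - col p.2 | p <- ps] ++ ds) F != 0 ->
    exists2 zs, all2 (fun z p => (z == p.1) || (z == p.2)) zs ps &
      per_on (cs ++ [seq col z | z <- zs] ++ ds) F != 0.
  exact: (H [::]).
elim: ps cs => [|p ps IH] cs /=; first by exists [::].
rewrite per_on_sub => nz.
pose rest := [seq col p.1 - col p.2 | p <- ps] ++ ds.
have /orP[] : (per_on (cs ++ col p.1 :: rest) F != 0)
    || (per_on (cs ++ col p.2 :: rest) F != 0).
- by rewrite -negb_and; apply: contraNN nz => /andP[/eqP-> /eqP->]; rewrite subrr.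
- rewrite -cat_rcons => /IH[zs zsP nzs]; exists (p.1 :: zs) => /=.
    by rewrite eqxx.
  by rewrite -cat_rcons.
- rewrite -cat_rcons => /IH[zs zsP nzs]; exists (p.2 :: zs) => /=.
    by rewrite eqxx orbT.
  by rewrite -cat_rcons.
Qed.

End PermanentOn.

(** * Permanents of matrices *)
Lemma expand_permanent_col (R : comNzRingType) n (A : 'M[R]_n.+1) :
  permanent A = \sum_i A i ord0 * permanent (row' i (col' ord0 A)).
Proof.
rewrite /permanent (partition_big (fun s : 'S_n.+1 => (s^-1)%g ord0) xpredT) //=.
apply: eq_bigr => i0 _.
rewrite (reindex (lift_perm i0 ord0)); last first.
  pose ulsf i (s : 'S_n.+1) k := odflt k (unlift (s i) (s (lift i k))).
  have ulsfK i (s : 'S_n.+1) k: lift (s i) (ulsf i s k) = s (lift i k).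
    rewrite /ulsf; have:= neq_lift i k.
    by rewrite -(can_eq (permK s)) => /unlift_some[] ? ? ->.
  have inj_ulsf: injective (ulsf i0 _).
    move=> s; apply: can_inj (ulsf (s i0) s^-1%g) _ => k'.
    by rewrite {1}/ulsf ulsfK !permK liftK.
  exists (fun s => perm (inj_ulsf s)) => [s _ | s].
    by apply/permP=> k'; rewrite permE /ulsf lift_perm_lift lift_perm_id liftK.
  move=> /eqP si0'; have si0 : s i0 = ord0 by rewrite -si0' permKV.
  apply/permP=> k.
  case: (unliftP i0 k) => [k'|] ->; rewrite ?lift_perm_id //.
  by rewrite lift_perm_lift -si0 permE ulsfK.
rewrite big_distrr /=; apply: eq_big => [s|s _].
  have {2}<- := lift_perm_id i0 ord0 s.
  by rewrite permK eqxx.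
rewrite (bigD1_ord i0) //= lift_perm_id; congr (_ * _).
by apply: eq_bigr => k _; rewrite !mxE lift_perm_lift.
Qed.

Lemma per_on_permanent (R : numFieldType) (E : finType) n
    (cs : seq {ffun E -> R}) (g : 'I_n -> E) :
  injective g -> size cs = n ->
  per_on cs (g @: 'I_n) = permanent (\matrix_(i, j) nth 0 cs j (g i)).
Proof.
elim: n cs g => [|n IH] [|c cs] g injg //=.
  move=> _; have -> : g @: 'I_0 = set0.
    by apply/setP=> x; rewrite !inE; apply/imsetP=> -[[]].
  rewrite eqxx /permanent (eq_bigr (fun=> 1)) => [|s _]; last by rewrite big_ord0.
  by rewrite sumr_const card_Sn.
move=> [sz]; rewrite expand_permanent_col big_imset /=; last first.
  by move=> ? ? _ _; apply: injg.
apply: eq_bigr => i _; rewrite mxE /=; congr (_ * _).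
have -> : (g @: 'I_n.+1) :\ g i = (g \o lift i) @: 'I_n.
  apply/setP => x; rewrite !inE; apply/andP/imsetP.
    case=> ne /imsetP[j _ xE]; case: (unliftP i j) ne => [k|] jE; rewrite xE jE.
      by exists k.
    by rewrite eqxx.
  case=> k _ ->; split; last by rewrite /= imset_f.
  by rewrite /= (inj_eq injg) eq_sym neq_lift.
rewrite IH //; last by apply: inj_comp injg lift_inj.
by congr permanent; apply/matrixP => k l; rewrite !mxE.
Qed.

(** * Combinatorial Nullstellensatz *)

(** A column of the inverse Vandermonde matrix: these weights on the nodes [t]
    extract the coefficient of degree [n] from polynomials of degree at most
    [k]. *)
Lemma dual_weights (F : fieldType) k (t : 'I_k.+1 -> F) (n : 'I_k.+1) :
  injective t ->
  exists w : 'I_k.+1 -> F,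
    forall q : 'I_k.+1, \sum_l w l * t l ^+ q = (q == n)%:R.
Proof.
move=> injt; pose V := Vandermonde k.+1 (\row_l t l).
have Vunit : V \in unitmx.
  rewrite unitmxE det_Vandermonde unitfE; apply/prodf_neq0 => i _.
  apply/prodf_neq0 => j ij; rewrite !mxE subr_eq0 (inj_eq injt).
  by apply: contraTneq ij => ->; rewrite ltnn.
exists (fun l => invmx V l n) => q.
have /matrixP/(_ q n) := mulmxV Vunit; rewrite !mxE => <-.
by apply: eq_bigr => l _; rewrite !mxE mulrC.
Qed.

Section Fibres.
Variables (m n : nat).
Implicit Types f g : {ffun 'I_m -> 'I_n}.

(** A choice of one variable from each of [m] linear forms contributes to the
    monomial whose exponents are the sizes of its fibres. *)
Definition same_fibres f g :=
  [forall j, #|[set i | f i == j]| == #|[set i | g i == j]|].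

Lemma same_fibres_perm f g : same_fibres f g ->
  exists s : 'S_m, forall i, f i = g (s i).
Proof.
move=> /forallP fg.
have cnt (h : {ffun 'I_m -> 'I_n}) j :
    count_mem j [tuple h i | i < m] = #|[set i | h i == j]|.
  rewrite /= count_map -sum1_count big_enum_cond -sum1_card.
  by apply: eq_bigl => i; rewrite !inE.
have /tuple_permP[s sP] : perm_eq [tuple f i | i < m] [tuple g i | i < m].
  by apply/allP => j _ /=; rewrite !(cnt, eqP (fg j)).
exists s => i; move/val_inj: sP => /(congr1 (fun u => tnth u i)).
by rewrite !tnth_mktuple.
Qed.

(** The sum in the conclusion is the coefficient, in the product of the row forms
    of [A], of the monomial whose exponents are the sizes of the fibres of [f]. Each term occurs in the
    permanent once for every permutation that preserves the fibres of [f]. *)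
Lemma permanent_colsub_neq0 (R : comNzRingType) (A : 'M[R]_(m, n)) f :
  permanent (colsub f A) != 0 ->
  \sum_(g | same_fibres g f) \prod_i A i (g i) != 0.
Proof.
apply: contraNneq => sum0; apply/eqP; rewrite /permanent.
pose p (s : 'S_m) := [ffun i => f (s i)].
have psame s : same_fibres (p s) f.
  apply/forallP => j; rewrite -(card_preimset [set i | f i == j] (@perm_inj _ s)).
  by apply/eqP/eq_card => i; rewrite !inE ffunE.
rewrite (partition_big p (same_fibres^~ f)) //=.
(* All the sets of permutations s with f o s = g are cosets of the same group. *)
pose N := #|[set s | p s == f]|.
transitivity ((\sum_(g | same_fibres g f) \prod_i A i (g i)) *+ N); last first.
  by rewrite sum0 mul0rn.
rewrite -sumrMnl; apply: eq_bigr => g /same_fibres_perm[t tP].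
have key s : (p s == g) = (p (t^-1 * s)%g == f).
  apply/eqP/eqP => sg; apply/ffunP => i.
    by have /ffunP/(_ (t^-1%g i)) := sg; rewrite !ffunE permM tP permKV.
  by have /ffunP/(_ (t i)) := sg; rewrite !ffunE permM permK tP.
transitivity (\sum_(s | p s == g) \prod_i A i (g i)).
  by apply: eq_bigr => s /eqP <-; apply: eq_bigr => i _; rewrite mxE ffunE.
rewrite sumr_const; congr (_ *+ _); rewrite /N -(card_preimset _ (mulgI t^-1%g)).
by apply: eq_card => s; rewrite !in_set; apply: key.
Qed.

End Fibres.

Lemma big_option (R : Type) (idx : R) (op : Monoid.com_law idx) (I : finType)
    (F : option I -> R) :
  \big[op/idx]_o F o = op (F None) (\big[op/idx]_i F (Some i)).
Proof.
rewrite (bigD1 None) //=; congr (op _ _).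
rewrite (reindex_omap Some id) => [|[]//].
by apply: eq_bigl => i; rewrite /= eqxx.
Qed.

(** Suppose that the product of the [m] affine forms vanishes on the whole grid.
    Summing its values over the grid with product weights dual to the exponents of the
    monomial given by [f] gives 0. Expanding the product first, only the monomials
    whose exponent is at least that of [f] in each variable survive; as the
    degree is at most [m], that leaves the monomial of [f] itself, whose
    coefficient is not 0. *)
Lemma nullstellensatz (R : fieldType) m n k (A : 'M[R]_(m, n))
    (f : {ffun 'I_m -> 'I_n}) (b : 'I_m -> R) (t : 'I_n -> 'I_k.+1 -> R) :
    (forall j, injective (t j)) ->
    permanent (colsub f A) != 0 ->
    (forall j, (#|[set i | f i == j]| <= k)%N) ->
  exists x : {ffun 'I_n -> 'I_k.+1},
    forall i, b i + \sum_j A i j * t j (x j) != 0.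
Proof.
move=> injt /permanent_colsub_neq0 Anz fk.
pose fib j := #|[set i | f i == j]|.
have [w wP] : exists w : {ffun 'I_n -> {ffun 'I_k.+1 -> R}}, forall j (q : 'I_k.+1),
    \sum_l w j l * t j l ^+ q = (q == inord (fib j))%:R.
  have /fin_all_exists[w wP] j := dual_weights (inord (fib j)) (injt j).
  exists [ffun j => [ffun l => w j l]] => j q; rewrite -wP.
  by apply: eq_bigr => l _; rewrite !ffunE.
have [//|noX] := pselect (exists x : {ffun 'I_n -> 'I_k.+1},
    forall i, b i + \sum_j A i j * t j (x j) != 0).
(* [None] stands for the constant term of an affine form. *)
pose a i o := oapp (A i) (b i) o.
pose y (x : {ffun 'I_n -> 'I_k.+1}) o := oapp (fun j => t j (x j)) 1 o.
have : \sum_(x : {ffun 'I_n -> 'I_k.+1}) (\prod_j w j (x j)) *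
    \prod_i \sum_o a i o * y x o = 0.
  apply: big1 => x _; have [i iz] : exists i, b i + \sum_j A i j * t j (x j) = 0.
    apply: contra_notP noX => nz; exists x => i.
    by apply/eqP => iz; apply: nz; exists i.
  by rewrite (bigD1 i) //= big_option /= mulr1 iz mul0r mulr0.
pose mu (g : {ffun 'I_m -> option 'I_n}) j := #|[set i | g i == Some j]|.
have yE x (g : {ffun 'I_m -> option 'I_n}) :
    \prod_i y x (g i) = \prod_j t j (x j) ^+ mu g j.
  rewrite (partition_big (fun i => g i) xpredT) //= big_option /=.
  rewrite big1 => [|i /eqP -> //].
  rewrite mul1r; apply: eq_bigr => j _.
  rewrite (eq_bigr (fun=> t j (x j))) => [|i /eqP -> //].
  by rewrite prodr_const; congr (_ ^+ _); apply: eq_card => i; rewrite !inE.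
have -> : \sum_(x : {ffun 'I_n -> 'I_k.+1}) (\prod_j w j (x j)) *
      \prod_i \sum_o a i o * y x o =
    \sum_(g : {ffun 'I_m -> option 'I_n}) (\prod_i a i (g i)) *
      \prod_j \sum_l w j l * t j l ^+ mu g j.
  under eq_bigr do rewrite bigA_distr_bigA big_distrr /=.
  rewrite exchange_big /=; apply: eq_bigr => g _.
  rewrite bigA_distr_bigA big_distrr /=; apply: eq_bigr => x _.
  by rewrite big_split /= yE mulrCA big_split.
have fib_lt j : (fib j < k.+1)%N by rewrite ltnS fk.
have sum_fib : (\sum_j fib j = m)%N.
  rewrite -[RHS]card_ord -sum1_card (partition_big (fun i => f i) xpredT) //=.
  by apply: eq_bigr => j _; rewrite sum1_card; apply: eq_card => i; rewrite !inE.
have sum_mu g : (\sum_j mu g j <= m)%N.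
  rewrite -[X in (_ <= X)%N]card_ord -sum1_card.
  rewrite (partition_big (fun i => g i) xpredT) //= big_option /=.
  apply: leq_trans (leq_addl _ _); apply: leq_sum => j _.
  by rewrite sum1_card; apply/subset_leq_card/subsetP => i; rewrite !inE.
(* The exponents of [f] have total degree m, the largest possible. *)
have mu_min g : (forall j, fib j <= mu g j)%N -> forall j, mu g j = fib j.
  move=> le j; apply/eqP; rewrite eqn_leq le andbT leqNgt; apply/negP => lt.
  have := sum_mu g; rewrite leqNgt -[X in (X < _)%N]sum_fib => /negP; apply.
  by rewrite (bigD1 j) //= [X in (_ < X)%N](bigD1 j) //= -addSn leq_add ?leq_sum.
rewrite (bigID (fun g : {ffun 'I_m -> option 'I_n} =>
  [forall j, mu g j == fib j])) /= [X in _ + X]big1 ?addr0; last first.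
  move=> g; rewrite negb_forall => /existsP[j0 ne].
  have [j lt] : exists j, (mu g j < fib j)%N.
    apply/existsP; apply: contraNT ne; rewrite negb_exists => /forallP le.
    by rewrite mu_min // => j; rewrite leqNgt le.
  rewrite [X in _ * X](bigD1 j) //=.
  have lt' : (mu g j < k.+1)%N by apply: ltn_trans lt (fib_lt j).
  have /= -> := wP j (Ordinal lt').
  rewrite -val_eqE /= inordK ?(ltn_eqF lt) ?mul0r ?mulr0 //.
rewrite (reindex_onto (fun h : {ffun 'I_m -> 'I_n} => [ffun i => Some (h i)])
  (fun g => [ffun i => odflt (f i) (g i)])) /=; last first.
  move=> g /forallP gP; apply/ffunP => i; rewrite !ffunE.
  have: (\sum_o #|[set i | g i == o]| = m)%N.
    rewrite -[RHS]card_ord -sum1_card [RHS](partition_big (fun i => g i) xpredT) //=.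
    by apply: eq_bigr => o _; rewrite sum1_card; apply: eq_card => i'; rewrite !inE.
  rewrite big_option /= (eq_bigr fib) => [|j _]; last by apply/eqP/gP.
  rewrite sum_fib => /eqP; rewrite -[X in _ == X]add0n eqn_add2r cards_eq0.
  by move=> /eqP/setP/(_ i); rewrite !inE; case: (g i).
move=> sum0; case/eqP: Anz; rewrite -[RHS]sum0; apply: eq_big => [h|h hf].
  rewrite /same_fibres.
  have -> : [ffun i => odflt (f i) ([ffun i => Some (h i)] i)] == h.
    by apply/eqP/ffunP => i; rewrite !ffunE.
  rewrite andbT; apply: eq_forallb => j; congr (_ == _).
  by apply: eq_card => i; rewrite !inE ffunE.
have muE j : mu [ffun i => Some (h i)] j = fib j.
  have /forallP/(_ j)/eqP := hf; rewrite -/(fib j) => <-.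
  by apply: eq_card => i; rewrite !inE ffunE.
rewrite [X in _ * X]big1 ?mulr1 => [|j _].
  by apply: eq_bigr => i _; rewrite ffunE.
by rewrite muE; have := wP j (inord (fib j)); rewrite inordK // eqxx => ->.
Qed.

(** * Edges and neighbourhoods in induced subgraphs *)
Section Graph.
Variable G : sgraph.
Implicit Types (W : {set G}) (u v w x y z a b p q : G) (e f r : {set G}).

Definition nbh W v := [set u in W | adj v u].
Definition edges_in W := [set e in edge_set G | e \subset W].

Lemma adjxx v : adj v v = false. Proof. exact: adj_irrefl. Qed.

Lemma adj_neq u v : adj u v -> u != v.
Proof. by apply: contraTneq => ->; rewrite adjxx. Qed.

Lemma edge_setP e :
  reflect (exists u v, adj u v /\ e = [set u; v]) (e \in edge_set G).
Proof.
rewrite inE; apply: (iffP existsP) => [[u /existsP[v /andP[uv /eqP ->]]]|].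
  by exists u, v.
by case=> u [v [uv ->]]; exists u; apply/existsP; exists v; rewrite uv eqxx.
Qed.

Lemma edge_inP W e :
  reflect (exists u v, [/\ adj u v, u \in W, v \in W & e = [set u; v]])
    (e \in edges_in W).
Proof.
rewrite inE; apply: (iffP andP) => [[/edge_setP[u [v [uv ->]]]]|].
  by rewrite subUset !sub1set => /andP[uW vW]; exists u, v.
case=> u [v [uv uW vW ->]]; split; first by apply/edge_setP; exists u, v.
by rewrite subUset !sub1set uW.
Qed.

Lemma set2_eq u v x y : [set u; v] = [set x; y] ->
  (u = x /\ v = y) \/ (u = y /\ v = x).
Proof.
move=> E.
have : u \in [set x; y] by rewrite -E !inE eqxx.
have : v \in [set x; y] by rewrite -E !inE eqxx orbT.
have : x \in [set u; v] by rewrite E !inE eqxx.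
have : y \in [set u; v] by rewrite E !inE eqxx orbT.
rewrite !inE => /orP[]/eqP-> /orP[]/eqP-> /orP[]/eqP ? /orP[]/eqP ?; subst; auto.
Qed.

Lemma set2_in_edge_set u v : ([set u; v] \in edge_set G) = adj u v.
Proof.
apply/edge_setP/idP => [[x [y [xy]]]|uv]; last by exists u, v.
by case/set2_eq => -[-> ->] //; rewrite adj_sym.
Qed.

Lemma set2_edges_in W u v :
  ([set u; v] \in edges_in W) = [&& adj u v, u \in W & v \in W].
Proof. by rewrite inE set2_in_edge_set subUset !sub1set. Qed.

Lemma edge_two_ends e u v :
  e \in edge_set G -> u \in e -> v \in e -> u != v -> e = [set u; v].
Proof.
move=> /edge_setP[x [y [_ ->]]]; rewrite !inE.
by case/orP=> /eqP-> /orP[]/eqP->; rewrite ?eqxx // setUC.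
Qed.

Lemma edges_inS W W' : W' \subset W -> edges_in W' \subset edges_in W.
Proof.
move=> sW; apply/subsetP => e; rewrite !inE => /andP[-> /=] h.
exact: subset_trans h sW.
Qed.

Lemma edges_in_edge_set W e : e \in edges_in W -> e \in edge_set G.
Proof. by rewrite inE => /andP[]. Qed.

Lemma edges_in_sub W e v : e \in edges_in W -> v \in e -> v \in W.
Proof. by rewrite inE => /andP[_ /subsetP]; apply. Qed.

Lemma edges_inD W S e v : e \in edges_in (W :\: S) -> v \in S -> v \notin e.
Proof.
by move=> eW vS; apply/negP => /(edges_in_sub eW); rewrite inE vS.
Qed.

Lemma edges_inD2E W p q e : (e \in edges_in (W :\: [set p; q])) =
  [&& e \in edges_in W, p \notin e & q \notin e].
Proof.
rewrite !inE subsetD andbA; congr (_ && _).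
by rewrite disjoint_sym disjoints_subset subUset !sub1set !in_setC.
Qed.

Definition star_edges W v := [set [set v; z] | z in nbh W v].

Lemma set2_inj v : injective (fun z : G => [set v; z]).
Proof. by move=> y z /set2_eq[[]|[<- ->]]. Qed.

Lemma card_star_edges W v : #|star_edges W v| = #|nbh W v|.
Proof. by rewrite card_imset //; apply: set2_inj. Qed.

Lemma star_edgesP W v e : v \in W ->
  (e \in star_edges W v) = (e \in edges_in W) && (v \in e).
Proof.
move=> vW; apply/imsetP/andP => [[z]|[/edge_inP[x [y [xy xW yW ->]]]]].
  by rewrite inE => /andP[zW vz] ->; rewrite set2_edges_in vz vW zW set21.
rewrite !inE => /orP[]/eqP vE; first by exists y; rewrite ?inE vE ?yW.
by exists x; rewrite 1?setUC ?inE vE ?xW // adj_sym.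
Qed.

Lemma edges_in_nonadj W a b : a \in W -> b \in W -> ~~ adj a b -> a != b ->
  edges_in W = star_edges W a :|: star_edges W b :|: edges_in (W :\: [set a; b]).
Proof.
move=> aW bW ab anb; apply/setP => e; rewrite !in_setU !star_edgesP //.
by rewrite edges_inD2E; case: (e \in edges_in W); case: (a \in e); case: (b \in e).
Qed.

Definition side_edges W p q := [set e in edges_in W | (p \in e) (+) (q \in e)].

Lemma side_edgesE W p q e :
  (e \in side_edges W p q) = (e \in edges_in W) && ((p \in e) (+) (q \in e)).
Proof. exact: in_set. Qed.

Lemma card_side_edges W p q : p \in W -> q \in W -> adj p q ->
  (#|side_edges W p q|.+2 = #|nbh W p| + #|nbh W q|)%N.
Proof.
move=> pW qW pq; rewrite -!card_star_edges.
have pqW : [set p; q] \in edges_in W by rewrite set2_edges_in pq pW.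
have -> : side_edges W p q =
    (star_edges W p :\ [set p; q]) :|: (star_edges W q :\ [set p; q]).
  apply/setP => e; rewrite side_edgesE in_setU !in_setD1 !star_edgesP //.
  have [eW|//] := boolP (e \in edges_in W); rewrite ?andbF //=.
  have [->|ne] /= := eqVneq e [set p; q]; first by rewrite !inE !eqxx orbT.
  have [pe|pe] := boolP (p \in e); have [qe|qe] := boolP (q \in e) => //=.
  by case/eqP: ne; apply: (edge_two_ends (edges_in_edge_set eW)) => //; apply: adj_neq.
rewrite cardsU [X in (_ - X)%N](_ : _ = 0)%N ?subn0; last first.
  apply/eqP; rewrite cards_eq0; apply/eqP/setP => e.
  rewrite in_setI !in_setD1 in_set0 !star_edgesP //.
  apply/negP => /andP[/andP[ne /andP[eW pe]] /andP[_ /andP[_ qe]]].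
  by case/eqP: ne; apply: (edge_two_ends (edges_in_edge_set eW)) => //; apply: adj_neq.
rewrite (cardsD1 [set p; q] (star_edges W p)) (cardsD1 [set p; q] (star_edges W q)).
by rewrite !star_edgesP // pqW !inE !eqxx orbT /= !add1n addSn addnS.
Qed.

Lemma edges_in_edge W p q : p \in W -> q \in W -> adj p q ->
  edges_in W =
  side_edges W p q :|: ([set p; q] |: edges_in (W :\: [set p; q])).
Proof.
move=> pW qW pq; apply/setP => e.
rewrite in_setU in_setU1 side_edgesE edges_inD2E.
have [->|ne] := eqVneq e [set p; q]; first by rewrite orbT set2_edges_in pq pW.
have [eW|//] /= := boolP (e \in edges_in W).
have [pe|pe] := boolP (p \in e); have [qe|qe] := boolP (q \in e) => //=.
by case/eqP: ne; apply: (edge_two_ends (edges_in_edge_set eW)) => //; apply: adj_neq.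
Qed.

Lemma side_edge_notD W p q e :
  e \in side_edges W p q -> e \notin edges_in (W :\: [set p; q]).
Proof.
rewrite side_edgesE => /andP[_ pqe]; apply/negP => eW.
by move: pqe; rewrite !(negPf (edges_inD eW _)) // !inE eqxx ?orbT.
Qed.

Lemma ltn_cardD (T : finType) (A S : {set T}) (c : T) :
  c \in A -> c \in S -> (#|A :\: S| < #|A|)%N.
Proof.
move=> cA cS; apply: proper_card; apply/properP; split; first exact: subsetDl.
by exists c; rewrite ?inE ?cS.
Qed.

Lemma nbhD W S z : nbh (W :\: S) z = nbh W z :\: S.
Proof. by apply/setP => y; rewrite !inE andbA. Qed.

Lemma card_nbhD2 W a b z : a \in W -> b \in W -> a != b ->
  #|nbh W z| = (#|nbh (W :\: [set a; b]) z| + (adj z a + adj z b))%N.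
Proof.
move=> aW bW ab; rewrite nbhD (cardsD1 a) (cardsD1 b (_ :\ _)) setDDl.
by rewrite !inE aW bW eq_sym ab /= addnA addnC.
Qed.

(** No component of the subgraph induced by [W] is a K_2: the two ends of such a
    component are the only adjacent vertices whose degrees add up to 2. *)
Definition no_isolated_edge W := forall u v, u \in W -> v \in W -> adj u v ->
  (2 < #|nbh W u| + #|nbh W v|)%N.

Lemma no_isolated_edge_closed W W' : W' \subset W ->
    (forall z, z \in W' -> nbh W z \subset W') ->
  no_isolated_edge W -> no_isolated_edge W'.
Proof.
move=> sW cl noW.
have nbhE z : z \in W' -> nbh W' z = nbh W z.
  move=> zW'; apply/setP => y; apply/idP/idP => [|yz].
    by rewrite !inE => /andP[/(subsetP sW) -> ->].
  rewrite inE (subsetP (cl z zW') y yz) /=.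
  by move: yz; rewrite inE => /andP[].
by move=> u v uW vW uv; rewrite !nbhE // noW // (subsetP sW).
Qed.

Lemma nbh_gt0 W u v : v \in W -> adj u v -> (0 < #|nbh W u|)%N.
Proof. by move=> vW uv; apply/card_gt0P; exists v; rewrite inE vW. Qed.

Lemma handshake W : (\sum_(v in W) #|nbh W v| = 2 * #|edges_in W|)%N.
Proof.
transitivity (\sum_(v in W) \sum_(e in edges_in W) (v \in e))%N.
  apply: eq_bigr => v vW; rewrite -card_star_edges -sum1_card.
  rewrite [LHS](eq_bigl (fun e => (e \in edges_in W) && (v \in e))) => [|e].
    by rewrite big_mkcondr; apply: eq_bigr => e _; case: (v \in e).
  by rewrite star_edgesP.
rewrite exchange_big /= (eq_bigr (fun=> 2%N)); first by rewrite sum_nat_const mulnC.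
move=> e eW; have /edge_inP[x [y [xy xW yW ->]]] := eW.
rewrite -big_mkcondr /= sum1_card.
transitivity #|[set x; y]|; last by rewrite cards2 adj_neq.
apply: eq_card => z; rewrite [LHS]unfold_in !inE.
have [->|_] := eqVneq z x; first by rewrite xW.
by have [->|_] := eqVneq z y; rewrite ?yW ?andbF.
Qed.

(** Call leaf a vertex of degree 1 in [W], and let [H] be the set of the vertices
    of degree at least 2. Two leaves with a common neighbour are twins; otherwise
    a vertex with a leaf has degree at least 4, hence at least 3 in [H]. So all
    degrees in [H] are at least 2, and by sparsity their excess over 2 adds up to
    at most 2. Some vertex [a] has excess 0, since otherwise the total excess would
    be at least #|H| >= 4. Vertices of excess 0 have degree 2 and are adjacent only
    to vertices of positive excess. Hence the two neighbours [x] and [y] of [a]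
    have excess 1, and every other vertex of [H] is adjacent to exactly [x] and
    [y]. One of the three neighbours of [x] in [H] is neither [a] nor [y], and it
    is a twin of [a]. *)
Lemma exists_twins W :
    (forall X : {set G}, X \subset W -> (#|edges_in X| <= #|X|.+1)%N) ->
    edges_in W != set0 ->
    (forall u v, u \in W -> v \in W -> adj u v ->
       (5 <= #|nbh W u| + #|nbh W v|)%N) ->
  exists a b, [/\ a \in W, b \in W, a != b, nbh W a = nbh W b &
    (#|nbh W a| <= 2)%N].
Proof.
move=> sparse /set0Pn[e0 /edge_inP[s [t [st sW tW _]]]] deg5.
have [//|notwin] := pselect (exists a b, [/\ a \in W, b \in W, a != b,
   nbh W a = nbh W b & (#|nbh W a| <= 2)%N]).
have nbhP u v : (v \in nbh W u) = (v \in W) && adj u v by rewrite inE.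
have leaf_uniq u v v' : v \in nbh W u -> v' \in nbh W u ->
    u \in W -> #|nbh W v| = 1%N -> #|nbh W v'| = 1%N -> v = v'.
  rewrite !nbhP => /andP[vW uv] /andP[v'W uv'] uW d1 d1'.
  apply/eqP; apply: contra_notT notwin => ne; exists v, v'; split=> //.
    have [/eqP/cards1P[y yE] /eqP/cards1P[y' yE']] := (d1, d1').
    rewrite yE yE'.
    have /set1P <- : u \in [set y] by rewrite -yE nbhP uW adj_sym.
    have /set1P <- : u \in [set y'] by rewrite -yE' nbhP uW adj_sym.
    by [].
  by rewrite d1.
pose H := [set v in W | 1 < #|nbh W v|]%N.
have HW : H \subset W by apply/subsetP => v; rewrite inE => /andP[].
have HP v : (v \in H) = (v \in W) && (1 < #|nbh W v|)%N by rewrite inE.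
have nbhH v : nbh H v = nbh W v :&: H.
  apply/setP => y; rewrite [RHS]inE nbhP [LHS]inE.
  by rewrite [y \in H]HP; case: (y \in W); rewrite ?andbF //= andbC.
have degH v : v \in H -> (1 < #|nbh H v|)%N /\
    ((#|nbh H v| <= 2)%N -> nbh H v = nbh W v).
  rewrite HP => /andP[vW dv].
  have [sub|/subsetPn[w wv wH]] := boolP (nbh W v \subset H).
    by rewrite nbhH (setIidPl sub).
  have /andP[wW vw] : (w \in W) && adj v w by rewrite -nbhP.
  have dw : #|nbh W w| = 1%N.
    apply/eqP; rewrite eqn_leq (@nbh_gt0 _ _ v) ?(adj_sym w v) // andbT.
    by move: wH; rewrite HP wW -leqNgt.
  have d4 : (4 <= #|nbh W v|)%N by have := deg5 _ _ vW wW vw; rewrite dw addn1.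
  have -> : nbh H v = nbh W v :\ w.
    rewrite nbhH; apply/setP => y; rewrite in_setI in_setD1 andbC.
    have [yv|] := boolP (y \in nbh W v); rewrite ?andbF // !andbT.
    have [->|ne] := eqVneq y w; first exact: negbTE.
    have /andP[yW vy] : (y \in W) && adj v y by rewrite -nbhP.
    rewrite HP yW /= ltnNge; apply: contra ne => dy; apply/eqP.
    apply: (leaf_uniq v) => //; apply/eqP; rewrite eqn_leq dy.
    by rewrite (@nbh_gt0 _ _ v) // adj_sym.
  by move: d4; rewrite (cardsD1 w) wv; clear; lia.
pose f v := (#|nbh H v| - 2)%N.
have sumf : (\sum_(v in H) f v <= 2)%N.
  have : (\sum_(v in H) #|nbh H v| = \sum_(v in H) f v + 2 * #|H|)%N.
    rewrite mulnC -sum_nat_const -big_split /=; apply: eq_bigr => v /degH[d2 _].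
    by rewrite /f subnK.
  by rewrite handshake; have := sparse _ HW; clear; lia.
have HltA v : v \in H -> f v = 0%N -> nbh H v = nbh W v /\ #|nbh W v| = 2%N.
  move=> vH f0; have [d2 eqn] := degH v vH.
  have le2 : (#|nbh H v| <= 2)%N by move: f0; rewrite /f; lia.
  by rewrite -eqn //; split=> //; apply/eqP; rewrite eqn_leq le2.
have [h0 h0H] : exists h0, h0 \in H.
  have := deg5 _ _ sW tW st => d5.
  case: (leqP 2 #|nbh W s|) => ds; first by exists s; rewrite HP sW.
  by exists t; rewrite HP tW /=; lia.
have [a aH fa0] : exists2 a, a \in H & f a = 0%N.
  have [|/exists_inPn all_pos] := boolP [exists a in H, f a == 0%N].
    by case/exists_inP => a aH /eqP fa; exists a.
  have HleF : (#|H| <= \sum_(v in H) f v)%N.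
    by rewrite -sum1_card; apply: leq_sum => v /all_pos; rewrite lt0n.
  have : (#|nbh H h0| < #|H|)%N.
    rewrite (cardsD1 h0 H) h0H add1n ltnS; apply/subset_leq_card/subsetP => y.
    by rewrite inE => /andP[yH h0y]; rewrite in_setD1 yH eq_sym adj_neq.
  by have := all_pos _ h0H; rewrite /f; lia.
have [HaE da] := HltA a aH fa0.
have /cards2P[x [y [xy Na]]] : #|nbh W a| == 2%N by rewrite da.
have aW : a \in W by apply: (subsetP HW).
have nbr3 b z : b \in W -> #|nbh W b| = 2%N -> z \in nbh W b -> z \in H /\ (0 < f z)%N.
  move=> bW db; rewrite nbhP => /andP[zW bz].
  have dz : (3 <= #|nbh W z|)%N by have := deg5 _ _ bW zW bz; rewrite db.
  have zH : z \in H by rewrite HP zW ltnW.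
  split=> //; rewrite lt0n; apply/eqP => fz0; have [_ dz2] := HltA z zH fz0.
  by rewrite dz2 in dz.
have [xH fx] : x \in H /\ (0 < f x)%N by apply: (nbr3 a); rewrite // Na set21.
have [yH fy] : y \in H /\ (0 < f y)%N by apply: (nbr3 a); rewrite // Na set22.
have f1 z : z \in H -> z != x -> z != y -> f z = 0%N.
  move=> zH zx zy; move: sumf.
  rewrite (bigD1 x) //= (bigD1 y) ?yH 1?eq_sym //= (bigD1 z) ?zH ?zx ?zy //=.
  by move: fx fy; clear; lia.
have fx1 : f x = 1%N.
  move: sumf; rewrite (bigD1 x) //= (bigD1 y) ?yH 1?eq_sym //=.
  by move: fx fy; clear; lia.
have [b bx] : exists b, b \in nbh H x :\ a :\ y.
  apply/set0Pn; rewrite -card_gt0; have := cardsD1 a (nbh H x).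
  have := cardsD1 y (nbh H x :\ a); move: fx1; rewrite /f.
  by clear; case: (a \in _); case: (y \in _); lia.
move: bx; rewrite !in_setD1 => /and3P[nby nba].
rewrite inE => /andP[bH xb].
have nbx : b != x by rewrite eq_sym adj_neq.
have [_ db] := HltA b bH (f1 b bH nbx nby).
have bW : b \in W by apply: (subsetP HW).
exists a, b; split; rewrite 1?eq_sym ?da //.
apply/esym/eqP; rewrite eqEcard da db leqnn andbT Na; apply/subsetP => z bz.
have [zH fz] := nbr3 b z bW db bz; rewrite !inE -[_ || _]negbK negb_or.
by apply/negP => /andP[zx zy]; rewrite f1 in fz.
Qed.

(** * Deletions that preserve index at most 2 *)
Section Columns.
(** [eps r v] is the coefficient of s_v in the linear form of the edge [r]. *)
Variables (R : numFieldType) (eps : {set G} -> G -> R).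
Hypothesis eps_out : forall r v, r \in edge_set G -> v \notin r -> eps r v = 0.
Hypothesis eps_in : forall u v, adj u v -> eps [set u; v] u != 0.
Hypothesis eps_opp : forall u v, adj u v ->
  eps [set u; v] u + eps [set u; v] v = 0.

(** The derivations d_v and D_e, as columns. *)
Definition dvert v : {ffun {set G} -> R} := [ffun r => eps r v].
Definition col e : {ffun {set G} -> R} := \sum_(v in e) dvert v.

Lemma col2 u v : u != v -> col [set u; v] = dvert u + dvert v.
Proof. by move=> uv; rewrite /col big_setU1 ?inE //= big_set1. Qed.

Lemma eps_neq0 r v : r \in edge_set G -> (eps r v != 0) = (v \in r).
Proof.
move=> rE; case: (boolP (v \in r)) => [|vr]; last by rewrite eps_out ?eqxx.
case/edge_setP: rE => x [y [xy ->]]; rewrite !inE => /orP[]/eqP->.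
  exact: eps_in.
by rewrite setUC eps_in // adj_sym.
Qed.

Lemma col_neq0 u v r : adj u v -> r \in edge_set G ->
  (col [set u; v] r != 0) = (u \in r) (+) (v \in r).
Proof.
move=> uv rE; rewrite col2 ?adj_neq // !ffunE.
have [ur|ur] := boolP (u \in r); have [vr|vr] := boolP (v \in r) => /=.
- by rewrite (edge_two_ends rE ur vr) ?adj_neq // eps_opp ?eqxx.
- by rewrite (eps_out rE vr) addr0 eps_neq0.
- by rewrite (eps_out rE ur) add0r eps_neq0.
- by rewrite !eps_out // addr0 eqxx.
Qed.

(** The subgraph induced by [W] has index at most 2: [ys] lists the chosen
    columns. Edges are vertex sets of the ambient graph, so that the columns of an
    induced subgraph need no translation. *)
Definition pind_le2 W := exists ys : seq {set G},
  [/\ {subset ys <= edges_in W}, forall e, (count_mem e ys <= 2)%N &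
      per_on [seq col e | e <- ys] (edges_in W) != 0].

Lemma pind_le2_noedge W : edges_in W = set0 -> pind_le2 W.
Proof. by move=> E0; exists [::]; split; rewrite //= E0 eqxx oner_neq0. Qed.

Lemma pind_le2_extend W W' zs ys : W' \subset W ->
    {subset zs <= edges_in W :\: edges_in W'} ->
    (forall e, (count_mem e zs <= 2)%N) ->
    {subset ys <= edges_in W'} ->
    (forall e, (count_mem e ys <= 2)%N) ->
    per_on ([seq col e | e <- zs] ++ [seq col e | e <- ys]) (edges_in W) != 0 ->
  pind_le2 W.
Proof.
move=> /edges_inS sW zsW zs2 ysW ys2 nz.
exists (zs ++ ys); split; last by rewrite map_cat.
  move=> y; rewrite mem_cat => /orP[/zsW|/ysW /(subsetP sW) //].
  by rewrite inE => /andP[].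
move=> y; rewrite count_cat; have [yW'|yW'] := boolP (y \in edges_in W').
  rewrite [count_mem y zs](_ : _ = 0)%N ?add0n // -(count_pred0 zs).
  apply: eq_in_count => e /zsW; rewrite inE => /andP[eW' _].
  by apply/negbTE; apply: contraNneq eW' => /= ->.
rewrite [X in (_ + X)%N](_ : _ = 0)%N ?addn0 // -(count_pred0 ys).
apply: eq_in_count => e /ysW eW'.
by apply/negbTE; apply: contraNneq yW' => /= <-.
Qed.

(** The column of an edge is supported exactly on its side edges, so as many copies
    of it use up all of these. *)
Lemma per_on_side_edges W p q ds : p \in W -> q \in W -> adj p q ->
  per_on ds ([set p; q] |: edges_in (W :\: [set p; q])) != 0 ->
  per_on (nseq #|side_edges W p q| (col [set p; q]) ++ ds) (edges_in W) != 0.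
Proof.
move=> pW qW pq nz; rewrite (edges_in_edge pW qW pq).
have F0 r : r \in [set p; q] |: edges_in (W :\: [set p; q]) ->
    (r \in edge_set G) && ((p \in r) == (q \in r)).
  rewrite in_setU1 => /orP[/eqP ->|rW].
    by rewrite set2_in_edge_set pq !inE !eqxx orbT.
  rewrite (edges_in_edge_set rW).
  have out v : v \notin W :\: [set p; q] -> v \notin r.
    by apply: contraNN; apply: edges_in_sub.
  by rewrite (negPf (out p _)) ?(negPf (out q _)) // !inE eqxx ?orbT.
apply: (@per_on_block _ _ (col [set p; q])) => //.
- by rewrite size_nseq.
- by move=> r; rewrite inE => /andP[/edges_in_edge_set rE]; rewrite col_neq0.
- move=> r /F0/andP[rE /eqP pr]; apply/eqP; rewrite -[_ == _]negbK col_neq0 //.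
  by rewrite pr addbb.
- by move=> c /nseqP[-> _]; exists 1; rewrite ?oner_neq0 // => r _; rewrite mul1r.
Qed.

(** Sharing exactly one end is a symmetric relation between edges. *)
Lemma col_neq0_sym e r : e \in edge_set G -> r \in edge_set G ->
  (col e r != 0) = (col r e != 0).
Proof.
move=> eE rE; have /edge_setP[u [v [uv euv]]] := eE.
have /edge_setP[x [y [xy rxy]]] := rE.
rewrite {1}euv {2}rxy !col_neq0 // euv rxy !inE.
rewrite [x == u]eq_sym [x == v]eq_sym [y == u]eq_sym [y == v]eq_sym.
have [ux|ux] := eqVneq u x; have [vy|vy] := eqVneq v y;
  have [uy|uy] := eqVneq u y; have [vx|vx] := eqVneq v x => //; subst;
  by rewrite ?adjxx in uv xy.
Qed.

Lemma col_eq0 u v r : adj u v -> r \in edge_set G -> u \notin r -> v \notin r ->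
  col [set u; v] r = 0.
Proof.
move=> uv rE ur vr; apply/eqP; rewrite -[_ == _]negbK col_neq0 //.
by rewrite (negPf ur) (negPf vr).
Qed.

Lemma col_edges_inD W S (ys : seq {set G}) r : {subset ys <= edges_in (W :\: S)} ->
  r \in edge_set G -> r \subset S ->
  forall c, c \in [seq col e | e <- ys] -> c r = 0.
Proof.
move=> ysW rE rS c /mapP[e /ysW eW ->].
have out z : z \in e -> z \notin r.
  by move=> ze; apply/negP => /(subsetP rS) /(edges_inD eW); rewrite ze.
have /edge_inP[x [y [xy _ _ exy]]] := eW.
by rewrite exy col_eq0 // out // exy !inE eqxx ?orbT.
Qed.

(** The copies of the column of pq use up its side edges. The edge pq itself is left
    to one further column, that of a side edge [g]: the columns of the smaller
    graph vanish there. *)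
Lemma pind_le2_del_edge W p q : p \in W -> q \in W -> adj p q ->
    (0 < #|side_edges W p q| <= 2)%N ->
  pind_le2 (W :\: [set p; q]) -> pind_le2 W.
Proof.
move=> pW qW pq /andP[/card_gt0P[g gS] k2].
have [gW gpq] := andP (etrans (esym (side_edgesE W p q g)) gS).
have pqW : [set p; q] \in edges_in W by rewrite set2_edges_in pq pW.
have pqW' : [set p; q] \notin edges_in (W :\: [set p; q]).
  by rewrite set2_edges_in !inE eqxx /= !andbF.
have gne : [set p; q] != g.
  by apply: contraTneq gpq => <-; rewrite !inE !eqxx orbT.
case=> ys [ysW ys2 nz].
apply: (@pind_le2_extend _ (W :\: [set p; q])
  (rcons (nseq #|side_edges W p q| [set p; q]) g) ys) => //.
- exact: subsetDl.
- move=> e; rewrite mem_rcons inE in_setD => /orP[/eqP->|/nseqP[-> _]].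
    by rewrite gW side_edge_notD.
  by rewrite pqW pqW'.
- move=> e; rewrite -cats1 count_cat count_nseq /= addn0.
  have [<-|] := eqVneq [set p; q] e; last by case: (g == e).
  by rewrite eq_sym (negPf gne) mul1n addn0.
rewrite map_rcons map_nseq cat_rcons.
apply: per_on_side_edges => //; rewrite per_on_row1 //; last first.
  by apply: (col_edges_inD ysW) => //; apply: (edges_in_edge_set pqW).
rewrite mulf_neq0 // col_neq0_sym ?(edges_in_edge_set gW) ?(edges_in_edge_set pqW) //.
by rewrite col_neq0 // (edges_in_edge_set gW).
Qed.

(** Here deleting [p] and [q] leaves uv as a component, which alone has no nonzero
    permanent. The column of the side edge ab, used twice, is supported on the two
    rows pq and uv that remain outside the smallest graph. *)
Lemma pind_le2_del_edge2 W p q u v a b :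
    p \in W -> q \in W -> adj p q -> (#|side_edges W p q| <= 2)%N ->
    u \in W :\: [set p; q] -> v \in W :\: [set p; q] -> adj u v ->
    side_edges (W :\: [set p; q]) u v = set0 ->
    a \in [set p; q] -> b \in [set u; v] -> adj a b ->
  pind_le2 (W :\: [set p; q] :\: [set u; v]) -> pind_le2 W.
Proof.
move=> pW qW pq k2 uW vW uv side0 a_pq b_uv ab.
set f := [set p; q] in uW vW side0 a_pq *; set h := [set u; v] in b_uv *.
set W' := W :\: f in uW vW side0 *; set W'' := W' :\: h.
have fW : f \in edges_in W by rewrite set2_edges_in pq pW.
have hW' : h \in edges_in W' by rewrite set2_edges_in uv uW.
have fE := edges_in_edge_set fW; have hE := edges_in_edge_set hW'.
have ah : a \notin h := edges_inD hW' a_pq.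
have bf : b \notin f.
  by have := edges_in_sub hW' b_uv; rewrite in_setD => /andP[].
have g_f : col [set a; b] f != 0 by rewrite col_neq0 // a_pq (negPf bf).
have g_h : col [set a; b] h != 0 by rewrite col_neq0 // b_uv (negPf ah).
have aW : a \in W by case/set2P: a_pq => ->.
have bW : b \in W by have := edges_in_sub hW' b_uv; rewrite in_setD => /andP[].
have gW : [set a; b] \in edges_in W by rewrite set2_edges_in ab aW.
have W''W : edges_in W'' \subset edges_in W'.
  by apply: edges_inS; apply: subsetDl.
have gW'' : [set a; b] \notin edges_in W''.
  by rewrite set2_edges_in [b \in W'']in_setD b_uv !andbF.
have fW'' : f \notin edges_in W''.
  by rewrite /f set2_edges_in !in_setD !inE eqxx /= !andbF.
have gf : [set a; b] != f by apply: contraNneq bf => <-; rewrite set22.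
case=> ys [ysW ys2 nz].
apply: (@pind_le2_extend _ W''
  (nseq #|side_edges W p q| f ++ nseq 2 [set a; b]) ys) => //.
- by apply: subset_trans (subsetDl _ _) (subsetDl _ _).
- move=> e; rewrite mem_cat in_setD => /orP[]/nseqP[-> _].
    by rewrite fW fW''.
  by rewrite gW gW''.
- move=> e; rewrite count_cat !count_nseq /=.
  have [<-|_] := eqVneq f e; last by case: (_ == e).
  by rewrite (negPf gf) addn0 mul1n.
rewrite map_cat !map_nseq -catA.
apply: per_on_side_edges => //; rewrite -/f -/W'.
have side0' : edges_in W' = h |: edges_in W''.
  by rewrite (edges_in_edge uW vW uv) side0 set0U.
rewrite side0' setUA -[f |: [set h]]/([set f; h]).
have hf : h != f by apply: contraNneq bf => <-.
apply: (@per_on_block _ _ (col [set a; b])) => //.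
- by rewrite cards2 eq_sym hf.
- by move=> r /set2P[] ->.
- move=> r rW; have rE := edges_in_edge_set rW.
  apply: col_eq0 => //; last exact: edges_inD rW b_uv.
  exact: edges_inD (subsetP W''W _ rW) a_pq.
- by move=> c /nseqP[-> _]; exists 1; rewrite ?oner_neq0 // => r _; rewrite mul1r.
Qed.

(** For each common neighbour z the columns of az and bz differ by the derivation
    d_a - d_b, which is supported on the edges at [a] or [b]. Taking each of these
    differences twice gives as many columns as there are such edges, and uses
    each edge at most twice. *)
Lemma pind_le2_del_twins W a b : a \in W -> b \in W -> a != b ->
  nbh W a = nbh W b -> pind_le2 (W :\: [set a; b]) -> pind_le2 W.
Proof.
move=> aW bW anb twin.
have ab : ~~ adj a b.
  have : a \notin nbh W a by rewrite inE adjxx andbF.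
  by rewrite twin inE aW adj_sym.
pose ps := [seq ([set a; z], [set b; z]) | z <- enum (nbh W a)].
(* The pairs are taken twice, so the bound 2 allows each edge in one pair only. *)
have psP e : (count (fun c => (e == c.1) || (e == c.2)) ps <= 1)%N.
  rewrite /ps count_map.
  have [/hasP[z0]|] := boolP (has (preim (fun z => ([set a; z], [set b; z]))
      (fun c => (e == c.1) || (e == c.2))) (enum (nbh W a))); last first.
    by rewrite has_count -leqNgt => le0; apply: leq_trans le0 _.
  rewrite mem_enum => z0a ez0.
  have <- : count_mem z0 (enum (nbh W a)) = 1%N.
    by rewrite count_uniq_mem ?enum_uniq // mem_enum z0a.
  rewrite (@eq_in_count _ _ (pred1 z0)) // => z; rewrite mem_enum => za.
  apply/idP/eqP => [/= ez|->//].
  have nab y c : y \in nbh W a -> c \in [set a; b] -> y != c.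
    move=> ya /set2P[]->; apply: contraTneq ya => ->.
      by rewrite inE adjxx andbF.
    by rewrite twin inE adjxx andbF.
  have E c d y y' : c \in [set a; b] -> d \in [set a; b] -> y \in nbh W a ->
      [set c; y] = [set d; y'] -> y = y'.
    move=> cab dab ya /set2_eq[[_ //]|[_ yd]].
    by move: (nab _ _ ya dab); rewrite yd eqxx.
  case/orP: ez ez0 => /eqP -> /orP[] /eqP /= EE;
    by apply: E EE => //; rewrite !inE eqxx ?orbT.
pose I := star_edges W a :|: star_edges W b.
have IW' : [disjoint I & edges_in (W :\: [set a; b])].
  rewrite disjoints_subset; apply/subsetP => e.
  rewrite in_setC in_setU !star_edgesP //.
  by move=> /orP[]/andP[_ ae]; apply: contraTN ae => /edges_inD; apply;
    rewrite !inE eqxx ?orbT.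
have sI : size (ps ++ ps) = #|I|.
  rewrite size_cat size_map -cardE cardsU [X in (_ - X)%N](_ : _ = 0)%N ?subn0.
    by rewrite !card_star_edges twin.
  apply/eqP; rewrite cards_eq0; apply/eqP/setP => e.
  rewrite in_setI in_set0 !star_edgesP //.
  apply/negP => /andP[/andP[eW ae] /andP[_ be]].
  have := edge_two_ends (edges_in_edge_set eW) ae be anb => eE.
  by move: eW; rewrite eE set2_edges_in (negPf ab).
have psI c : c \in ps ++ ps -> (c.1 \in I) && (c.2 \in I).
  rewrite mem_cat orbb => /mapP[z]; rewrite mem_enum => za -> /=.
  have /andP[zW az] : (z \in W) && adj a z by move: za; rewrite inE.
  have /andP[_ bz] : (z \in W) && adj b z by move: za; rewrite twin inE.
  by rewrite !in_setU !star_edgesP // !set2_edges_in az bz aW bW zW !set21 orbT.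
have psD c : c \in ps ++ ps -> col c.1 - col c.2 = dvert a - dvert b.
  rewrite mem_cat orbb => /mapP[z]; rewrite mem_enum => za -> /=.
  have /andP[_ az] : (z \in W) && adj a z by move: za; rewrite inE.
  have /andP[_ bz] : (z \in W) && adj b z by move: za; rewrite twin inE.
  by rewrite !col2 ?adj_neq // opprD addrACA subrr addr0.
move=> [ys [ysW ys2 nz]].
have [zs zsP nzs] : exists2 zs,
    all2 (fun s t => (s == t.1) || (s == t.2)) zs (ps ++ ps) &
    per_on ([seq col e | e <- zs] ++ [seq col e | e <- ys]) (edges_in W) != 0.
  apply: per_on_choice; rewrite (edges_in_nonadj aW bW ab anb).
  apply: (@per_on_block _ _ (dvert a - dvert b)) => //.
  - by rewrite size_map.
  - move=> e; rewrite in_setU !star_edgesP // => eI; rewrite !ffunE.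
    have eE : e \in edge_set G by case/orP: eI => /andP[/edges_in_edge_set].
    have nz1 c : c \in e -> eps e c != 0 by rewrite eps_neq0.
    have [ae|ae] := boolP (a \in e); have [be|be] := boolP (b \in e).
    + have := eE; rewrite (edge_two_ends eE ae be anb) set2_in_edge_set.
      by rewrite (negPf ab).
    + by rewrite (eps_out eE be) subr0 nz1.
    + by rewrite (eps_out eE ae) sub0r oppr_eq0 nz1.
    + by rewrite (negPf ae) (negPf be) !andbF in eI.
  - move=> e eW; rewrite !ffunE !(eps_out (edges_in_edge_set eW)) ?subrr //.
      by apply: (edges_inD eW); rewrite !inE eqxx orbT.
    by apply: (edges_inD eW); rewrite !inE eqxx.
  - move=> c /mapP[pr /psD -> ->]; exists 1; rewrite ?oner_neq0 // => r _.
    by rewrite mul1r.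
have zs_ps e := all2_choice_count e zsP.
apply: (@pind_le2_extend _ (W :\: [set a; b]) zs ys) => //.
- exact: subsetDl.
- move=> e ezs; have : has (pred1 e) zs by rewrite has_pred1.
  rewrite has_count => /leq_trans/(_ (zs_ps e)); rewrite -has_count.
  case/hasP => c /psI /andP[c1 c2] ec.
  have eI : e \in I by case/orP: ec => /eqP ->.
  rewrite in_setD (disjointFr IW' eI) /=.
  by move: eI; rewrite in_setU !star_edgesP // => /orP[]/andP[].
- move=> e; apply: leq_trans (zs_ps e) _; rewrite count_cat.
  by have := psP e; lia.
Qed.

(** On a component the sum of all vertex derivations vanishes, hence the column of
    by is minus that of ax. The columns ax, ax, by are therefore proportional and
    supported on the rows xy, ay, bx; the columns xy, xy take the rows ax, by. *)
Lemma pind_le2_del_diamond W a b x y :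
    a != b -> a \in W -> b \in W -> x \in W -> y \in W ->
    nbh W a = [set x; y] -> nbh W b = [set x; y] ->
    nbh W x = [set a; b; y] -> nbh W y = [set a; b; x] ->
  pind_le2 (W :\: [set a; b] :\: [set x; y]) -> pind_le2 W.
Proof.
move=> anb aW bW xW yW Na Nb Nx Ny [ys [ysW ys2 nz]].
have adjE u v : u \in W -> v \in nbh W u -> adj u v by rewrite inE => _ /andP[].
have ax : adj a x by apply: adjE; rewrite // Na !inE eqxx.
have ay : adj a y by apply: adjE; rewrite // Na !inE eqxx orbT.
have bx : adj b x by apply: adjE; rewrite // Nb !inE eqxx.
have b_y : adj b y by apply: adjE; rewrite // Nb !inE eqxx orbT.
have xy : adj x y by apply: adjE; rewrite // Nx !inE eqxx !orbT.
have ne2 (u v : G) : u != v -> ((u == v) = false) * ((v == u) = false).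
  by rewrite [v == u]eq_sym => /negbTE ->.
have neq' := (ne2 _ _ (adj_neq ax), ne2 _ _ (adj_neq ay), ne2 _ _ (adj_neq bx),
  ne2 _ _ (adj_neq b_y), ne2 _ _ (adj_neq xy), ne2 _ _ anb).
have nab : ~~ adj a b.
  apply/negP => ab; have : b \in nbh W a by rewrite inE bW.
  by rewrite Na !inE !neq'.
set W1 := W :\: [set a; b] in ysW nz *; set W2 := W1 :\: [set x; y] in ysW nz *.
have xW1 : x \in W1 by rewrite !inE xW !neq'.
have yW1 : y \in W1 by rewrite !inE yW !neq'.
have N1 : nbh W1 x = [set y] /\ nbh W1 y = [set x].
  rewrite /W1 !nbhD Nx Ny; split; apply/setP => z; rewrite !inE;
    (have [->|_] := eqVneq z a; first by rewrite ?neq');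
    (have [->|_] := eqVneq z b; first by rewrite ?neq'); by [].
have side0 : side_edges W1 x y = set0.
  apply/eqP; rewrite -cards_eq0; have := card_side_edges xW1 yW1 xy.
  by case: N1 => -> ->; rewrite !cards1 => /eqP; rewrite !eqSS.
have starE v : nbh W v = [set x; y] -> star_edges W v = [set [set v; x]; [set v; y]].
  by move=> Nv; rewrite /star_edges Nv imsetU1 imset_set1.
pose I1 := [set [set x; y]; [set a; y]; [set b; x]].
pose I2 := [set [set a; x]; [set b; y]].
have EW : edges_in W = I1 :|: (I2 :|: edges_in W2).
  rewrite (edges_in_nonadj aW bW nab anb) -/W1 !starE //.
  rewrite (edges_in_edge xW1 yW1 xy) side0 set0U -/W2.
  apply/setP => e; rewrite !in_setU !in_set1.
  by case: (e == [set a; x]); case: (e == [set a; y]); case: (e == [set b; x]);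
    case: (e == [set b; y]); case: (e == [set x; y]).
have W2W v : v \in [set a; b; x; y] -> v \notin W2.
  by rewrite !inE -!orbA => /or4P[] /eqP ->; rewrite eqxx /= ?orbT ?andbF.
have out v e : v \in [set a; b; x; y] -> e \in edges_in W2 -> v \notin e.
  by move=> /W2W vW2 eW2; apply: contraNN vW2; apply: edges_in_sub.
have nW2 u v : u \in [set a; b; x; y] -> [set u; v] \notin edges_in W2.
  by move=> /out uW2; apply/negP => /uW2; rewrite set21.
have aS : a \in [set a; b; x; y] by rewrite !inE eqxx.
have bS : b \in [set a; b; x; y] by rewrite !inE eqxx ?orbT.
have xS : x \in [set a; b; x; y] by rewrite !inE eqxx ?orbT.
have yS : y \in [set a; b; x; y] by rewrite !inE eqxx ?orbT.
have set2_neq u v w z : u \notin [set w; z] -> [set u; v] != [set w; z].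
  by apply: contraNneq => <-; rewrite set21.
have d1 : [set a; x] != [set b; y] by rewrite set2_neq // !inE !neq'.
have d2 : [set a; x] != [set x; y] by rewrite set2_neq // !inE !neq'.
have d3 : [set b; y] != [set x; y] by rewrite set2_neq // !inE !neq'.
apply: (@pind_le2_extend _ W2
  [:: [set a; x]; [set a; x]; [set b; y]; [set x; y]; [set x; y]] ys) => //.
- by apply: subset_trans (subsetDl _ _) (subsetDl _ _).
- apply/allP; rewrite /= !in_setD !nW2 // !set2_edges_in.
  by rewrite ax b_y xy aW bW xW yW.
- move=> e /=; have [<-|_] := eqVneq [set a; x] e.
    by rewrite eq_sym (negPf d1) eq_sym (negPf d2).
  have [<-|_] := eqVneq [set b; y] e; first by rewrite eq_sym (negPf d3).
  by case: (_ == e).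
rewrite EW -[map _ [:: _, _, _, _ & _]]/(
  [:: col [set a; x]; col [set a; x]; col [set b; y]] ++
  [:: col [set x; y]; col [set x; y]]) -catA.
have edgeE e : e \in edges_in W -> e \in edge_set G by apply: edges_in_edge_set.
have I1E e : e \in I1 -> e \in edge_set G.
  by move=> eI; apply: edgeE; rewrite EW in_setU eI.
have I2E e : e \in I2 -> e \in edge_set G.
  by move=> eI; apply: edgeE; rewrite EW; apply/setUP; right; apply/setUP; left.
have W2E e : e \in edges_in W2 -> e \in edge_set G by apply: edges_in_edge_set.
apply: (@per_on_block _ _ (col [set a; x])) => //.
- have d4 : [set x; y] != [set a; y] by rewrite set2_neq // !inE !neq'.
  have d5 : [set x; y] != [set b; x] by rewrite eq_sym set2_neq // !inE !neq'.
  have d6 : [set a; y] != [set b; x] by rewrite set2_neq // !inE !neq'.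
  by rewrite /I1 cardsU cards1 cards2 d4 (_ : _ :&: _ = set0) ?cards0 //;
    apply/setP => e; rewrite !in_setI !inE;
    case: eqP => [->|_]; rewrite ?(negPf d5) ?(negPf d6) //=;
    case: eqP => [->|_]; rewrite ?(negPf d5) ?(negPf d6).
- move=> e eI; rewrite col_neq0 ?I1E //; move: eI.
  by rewrite !inE -orbA => /or3P[]/eqP->; rewrite !inE ?eqxx ?neq'.
- move=> e /setUP[eI|eW2]; last by apply: col_eq0; rewrite ?W2E ?out.
  apply/eqP; rewrite -[_ == _]negbK col_neq0 ?I2E //; move: eI.
  by move=> /set2P[]->; rewrite !inE ?eqxx ?neq'.
- move=> c; rewrite !inE => /or3P[] /eqP-> .
  + by exists 1; rewrite ?oner_neq0 // => r _; rewrite mul1r.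
  + by exists 1; rewrite ?oner_neq0 // => r _; rewrite mul1r.
  exists (-1) => [|r rW]; first by rewrite oppr_eq0 oner_neq0.
  have rE : r \in edge_set G by apply: edgeE; rewrite EW.
  have zero v : v \notin r -> eps r v = 0 by apply: eps_out.
  rewrite mulN1r !col2 ?neq' // !ffunE; apply/eqP; rewrite -addr_eq0.
  case/setUP: rW => [|/setUP[/set2P[]|]].
  - rewrite !in_setU !in_set1 -orbA => /or3P[]/eqP rr.
    + rewrite (zero b) ?(zero a) ?rr ?inE ?neq' // !add0r addrC.
      by rewrite eps_opp.
    + rewrite (zero b) ?(zero x) ?rr ?inE ?neq' // add0r addr0 addrC.
      by rewrite eps_opp.
    + rewrite (zero y) ?(zero a) ?rr ?inE ?neq' // add0r addr0.
      by rewrite eps_opp.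
  - by move=> rr; rewrite (zero b) ?(zero y) ?rr ?inE ?neq' // !add0r eps_opp.
  - by move=> rr; rewrite (zero a) ?(zero x) ?rr ?inE ?neq' // !addr0 eps_opp.
  - by move=> rW2; rewrite !zero ?addr0 //; apply: out rW2.
apply: (@per_on_block _ _ (col [set x; y])) => //.
- by rewrite cards2 d1.
- move=> e eI; rewrite col_neq0 ?I2E //; move: eI.
  by move=> /set2P[]->; rewrite !inE ?eqxx ?neq'.
- by move=> e eW2; apply: col_eq0; rewrite ?W2E ?out.
- move=> c; rewrite !inE orbb => /eqP->.
  by exists 1; rewrite ?oner_neq0 // => r _; rewrite mul1r.
Qed.

(** Suppose that deleting [p] and [q] creates a component uv. The degrees of [u] and
    [v] add up to 2 plus the number of edges between pq and uv, and those of
    [p] and [q] to at least that. As the latter sum is minimal, pq has no other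
    neighbours, and deleting all four vertices leaves the other components as
    they are. *)
Lemma pind_le2_light_edge W p q :
    no_isolated_edge W -> p \in W -> q \in W -> adj p q ->
    (#|nbh W p| + #|nbh W q| <= 4)%N ->
    (forall u v, u \in W -> v \in W -> adj u v ->
       (#|nbh W p| + #|nbh W q| <= #|nbh W u| + #|nbh W v|)%N) ->
    (forall W', (#|W'| < #|W|)%N -> no_isolated_edge W' -> pind_le2 W') ->
  pind_le2 W.
Proof.
move=> noW pW qW pq le4 minpq IH.
have cardS := card_side_edges pW qW pq.
have k2 : (#|side_edges W p q| <= 2)%N by move: le4; rewrite -cardS.
set W' := W :\: [set p; q].
have [noW'|] := pselect (no_isolated_edge W').
  apply: (@pind_le2_del_edge W p q) => //.
    by rewrite k2 andbT; have := noW p q pW qW pq; rewrite -cardS.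
  by apply: IH => //; rewrite (@ltn_cardD _ _ _ p) // set21.
case/existsNP => u /existsNP[v /not_implyP[uW' /not_implyP[vW' /not_implyP[uv deg2]]]].
have [uW vW] : u \in W /\ v \in W by case/setDP: uW' vW' => -> _ /setDP[->].
have [du dv] : #|nbh W' u| = 1%N /\ #|nbh W' v| = 1%N.
  have := nbh_gt0 vW' uv; have := @nbh_gt0 W' v u uW'; rewrite adj_sym => /(_ uv).
  by move/negP: deg2; rewrite -leqNgt; clear; lia.
have pneq := adj_neq pq; have uneq := adj_neq uv.
have degu := card_nbhD2 u pW qW pneq; have degv := card_nbhD2 v pW qW pneq.
have degp := card_nbhD2 p uW vW uneq; have degq := card_nbhD2 q uW vW uneq.
rewrite -/W' du in degu; rewrite -/W' dv in degv.
have pWu : p \in W :\: [set u; v].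
  rewrite in_setD pW andbT; apply/negP => /set2P[pE|pE].
    by rewrite -pE !inE eqxx in uW'.
  by rewrite -pE !inE eqxx in vW'.
have qWu : q \in W :\: [set u; v].
  rewrite in_setD qW andbT; apply/negP => /set2P[qE|qE].
    by rewrite -qE !inE eqxx orbT in uW'.
  by rewrite -qE !inE eqxx orbT in vW'.
have gp := nbh_gt0 qWu pq.
have gq : (0 < #|nbh (W :\: [set u; v]) q|)%N by apply: (nbh_gt0 pWu); rewrite adj_sym.
have [dp [dq cross]] : #|nbh (W :\: [set u; v]) p| = 1%N /\
    #|nbh (W :\: [set u; v]) q| = 1%N /\
    (0 < (adj p u + adj p v) + (adj q u + adj q v))%N.
  have := minpq u v uW vW uv; have := noW u v uW vW uv.
  rewrite degu degv degp degq ![adj u _]adj_sym ![adj v _]adj_sym.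
  move: gp gq; clear.
  by case: (adj p u); case: (adj p v); case: (adj q u); case: (adj q v); lia.
have single (X : {set G}) (s t w : G) :
    #|nbh X s| = 1%N -> t \in X -> adj s t -> w \in X -> adj s w -> w = t.
  move=> /eqP/cards1P[c cE] tX st wX sw.
  have /set1P -> : t \in [set c] by rewrite -cE inE tX.
  by apply/set1P; rewrite -cE inE wX.
have side0 : side_edges W' u v = set0.
  apply/eqP; rewrite -cards_eq0; have := card_side_edges uW' vW' uv.
  by rewrite du dv => /eqP; rewrite !eqSS.
have good'' : pind_le2 (W' :\: [set u; v]).
  apply: IH.
    apply: leq_ltn_trans (ltn_cardD pW (set21 p q)).
    exact/subset_leq_card/subsetDl.
  apply: (no_isolated_edge_closed _ _ noW).
    by apply: subset_trans (subsetDl _ _) (subsetDl _ _).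
  move=> z; rewrite in_setD in_set2 negb_or => /andP[/andP[zu zv] zW'].
  have /setDP[zW] := zW'; rewrite in_set2 negb_or => /andP[zp zq].
  have zWu : z \in W :\: [set u; v] by rewrite !inE negb_or zu zv.
  apply/subsetP => y; rewrite inE => /andP[yW zy].
  rewrite in_setD in_set2 negb_or in_setD in_set2 negb_or yW andbT.
  apply/andP; split; apply/andP; split; apply: contraTneq zy => ->;
    rewrite adj_sym; apply/negP => zy.
  - by move: zv; rewrite (single W' u v z du) ?eqxx.
  - by move: zu; rewrite (single W' v u z dv) ?eqxx // adj_sym.
  - by move: zq; rewrite (single (W :\: [set u; v]) p q z dp) ?eqxx.
  - by move: zp; rewrite (single (W :\: [set u; v]) q p z dq) ?eqxx // adj_sym.
have [s [t [spq tuv st]]] : exists s t,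
    [/\ s \in [set p; q], t \in [set u; v] & adj s t].
  move: cross.
  have [pu|_] := boolP (adj p u); first by exists p, u; rewrite !set21.
  have [pv|_] := boolP (adj p v); first by exists p, v; rewrite set21 set22.
  have [qu|_] := boolP (adj q u); first by exists q, u; rewrite set22 set21.
  by have [qv|//] := boolP (adj q v); exists q, v; rewrite !set22.
exact: (pind_le2_del_edge2 pW qW pq k2 uW' vW' uv side0 spq tuv st good'').
Qed.

(** Deleting the twins lowers the degrees of their common neighbours by 2, so an
    edge with at most one end among these keeps degree sum at least 3. Only an edge
    xy between the two common neighbours can become isolated; both of its ends then
    have degree 3, and [a], [b], [x], [y] form a K_4 minus an edge. *)
Lemma pind_le2_twins W a b :
    no_isolated_edge W -> a \in W -> b \in W -> a != b -> nbh W a = nbh W b ->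
    (#|nbh W a| <= 2)%N ->
    (forall u v, u \in W -> v \in W -> adj u v ->
       (5 <= #|nbh W u| + #|nbh W v|)%N) ->
    (forall W', (#|W'| < #|W|)%N -> no_isolated_edge W' -> pind_le2 W') ->
  pind_le2 W.
Proof.
move=> noW aW bW ab twin d2 deg5 IH.
set W' := W :\: [set a; b].
have [noW'|] := pselect (no_isolated_edge W').
  apply: (pind_le2_del_twins aW bW ab twin).
  by apply: IH => //; rewrite (@ltn_cardD _ _ _ a) // set21.
case/existsNP => x /existsNP[y /not_implyP[xW' /not_implyP[yW' /not_implyP[xy]]]].
move=> /negP; rewrite -leqNgt => degxy.
have [xW yW] : x \in W /\ y \in W by case/setDP: xW' yW' => -> _ /setDP[->].
have degW z : z \in W -> #|nbh W z| = (#|nbh W' z| + 2 * (z \in nbh W a))%N.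
  move=> zW; rewrite (card_nbhD2 z aW bW ab) -/W' !(adj_sym z).
  have -> : (z \in nbh W a) = adj a z by rewrite inE zW.
  have -> : adj b z = adj a z by have := in_set (fun u => (u \in W) && adj a u) z;
    rewrite -/(nbh W a) twin inE zW.
  by clear; case: (adj a z).
have gx := nbh_gt0 yW' xy.
have gy : (0 < #|nbh W' y|)%N by apply: (nbh_gt0 xW'); rewrite adj_sym.
have [xN yN] : x \in nbh W a /\ y \in nbh W a.
  have := deg5 x y xW yW xy; rewrite !degW //.
  move: gx gy degxy; clear; case: (x \in nbh W a); case: (y \in nbh W a); lia.
have Na : nbh W a = [set x; y].
  apply/esym/eqP; rewrite eqEcard cards2 (adj_neq xy) d2 andbT.
  by apply/subsetP => z /set2P[]->.
have [ax ay] : adj a x /\ adj a y.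
  by move: xN yN; rewrite !inE => /andP[_ ->] /andP[_ ->].
have [bx b_y] : adj b x /\ adj b y.
  by move: xN yN; rewrite twin !inE => /andP[_ ->] /andP[_ ->].
have neqs := (adj_neq ax, adj_neq ay, adj_neq bx, adj_neq b_y).
have [dx dy] : #|nbh W x| = 3%N /\ #|nbh W y| = 3%N.
  have := deg5 a x aW xW ax; have := deg5 a y aW yW ay.
  rewrite Na cards2 (adj_neq xy) !degW // xN yN.
  by move: gx gy degxy; clear; lia.
have nbh3 s t : adj a s -> adj b s -> adj s t -> t \in W -> a != t -> b != t ->
    #|nbh W s| = 3%N -> nbh W s = [set a; b; t].
  move=> sa sb st tW nat nbt d3; apply/esym/eqP; rewrite eqEcard d3.
  rewrite setUC cardsU1 cards2 in_set2 negb_or ![t == _]eq_sym nat nbt ab /= andbT.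
  apply/subsetP => z /setUP[/set1P->|/set2P[]->];
    by rewrite inE ?tW ?st ?aW ?bW // adj_sym.
have Nx : nbh W x = [set a; b; y] by apply: nbh3; rewrite ?neqs.
have Ny : nbh W y = [set a; b; x] by apply: nbh3; rewrite ?neqs // adj_sym.
apply: (pind_le2_del_diamond ab aW bW xW yW) => //; first by rewrite -twin.
apply: IH.
  apply: leq_ltn_trans (ltn_cardD aW (set21 a b)).
  exact/subset_leq_card/subsetDl.
apply: (no_isolated_edge_closed _ _ noW).
  by apply: subset_trans (subsetDl _ _) (subsetDl _ _).
have sym s t : t \in W -> s \in W -> (t \in nbh W s) = (s \in nbh W t).
  by move=> tW sW; rewrite !inE tW sW adj_sym.
move=> z; rewrite 2!in_setD !in_set2 !negb_or => /and3P[/andP[zx zy] /andP[za zb] zW].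
apply/subsetP => t tz; have tW : t \in W by move: tz; rewrite inE => /andP[].
rewrite 2!in_setD !in_set2 !negb_or tW andbT.
apply/andP; split; apply/andP; split; apply: contraTneq tz => ->; rewrite sym //.
- by rewrite Nx !inE !negb_or za zb.
- by rewrite Ny !inE !negb_or za zb.
- by rewrite Na !inE !negb_or zx.
- by rewrite -twin Na !inE !negb_or zx.
Qed.

(** Induction on the number of vertices. An edge of minimal degree sum is deleted if
    this sum is at most 4; otherwise there are twins to delete. *)
Lemma pind_le2_of_sparse W :
    (forall X : {set G}, (#|edges_in X| <= #|X|.+1)%N) ->
  no_isolated_edge W -> pind_le2 W.
Proof.
move=> sparse; have [n] := ubnP #|W|; elim: n W => // n IHn W; rewrite ltnS => Wn noW.
have IH W' : (#|W'| < #|W|)%N -> no_isolated_edge W' -> pind_le2 W'.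
  by move=> lt; apply: IHn; apply: leq_trans lt Wn.
have [/eqP E0|] := boolP (edges_in W == set0); first exact: pind_le2_noedge.
move=> Enz; have /set0Pn[_ /edge_inP[s [t [st sW tW _]]]] := Enz.
pose P (c : G * G) := [&& c.1 \in W, c.2 \in W & adj c.1 c.2].
have Pst : P (s, t) by rewrite /P sW tW.
case: (arg_minnP (fun c => #|nbh W c.1| + #|nbh W c.2|)%N Pst).
move=> -[p q] /and3P[/= pW qW pq] minpq.
have minpq' u v : u \in W -> v \in W -> adj u v ->
    (#|nbh W p| + #|nbh W q| <= #|nbh W u| + #|nbh W v|)%N.
  by move=> uW vW uv; apply: (minpq (u, v)); rewrite /P /= uW vW.
have [le4|gt4] := leqP (#|nbh W p| + #|nbh W q|) 4.
  exact: (pind_le2_light_edge noW pW qW pq le4 minpq' IH).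
have deg5 u v : u \in W -> v \in W -> adj u v -> (5 <= #|nbh W u| + #|nbh W v|)%N.
  by move=> uW vW uv; apply: leq_trans gt4 (minpq' u v uW vW uv).
have [a [b [aW bW ab twin d2]]] := exists_twins (fun X _ => sparse X) Enz deg5.
exact: (pind_le2_twins noW aW bW ab twin d2 deg5 IH).
Qed.

End Columns.
End Graph.

(** * Bicyclic graphs *)
Lemma edges_in_setT (G : sgraph) : edges_in [set: G] = edge_set G.
Proof. by apply/setP => e; rewrite inE subsetT andbT. Qed.

Lemma connected_boundary (G : sgraph) (X : {set G}) x0 y0 :
  graph_connected G -> x0 \in X -> y0 \notin X ->
  exists x u, [/\ x \in X, u \notin X & adj x u].
Proof.
move=> conn x0X y0X.
have [//|no] := pselect (exists x u, [/\ x \in X, u \notin X & adj x u]).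
have cl : closed (@adj G) (mem X).
  move=> x y xy; apply/idP/idP => [xX|yX].
    by apply: contra_notT no => yX; exists x, y.
  by apply: contra_notT no => xX; exists y, x; split; rewrite // adj_sym.
have := closed_connect cl (conn x0 y0).
by rewrite /= x0X (negPf y0X).
Qed.

(** While [X] is not everything, some edge leaves it; adding its other end gains at
    least that edge. *)
Lemma connected_edges_in (G : sgraph) (X : {set G}) x0 :
  graph_connected G -> x0 \in X ->
  (#|edges_in X| + #|G| <= #|edge_set G| + #|X|)%N.
Proof.
move=> conn; have [n] := ubnP #|~: X|; elim: n X => // n IHn X; rewrite ltnS => Xn x0X.
have [/eqP XT|] := boolP (X == setT).
  by rewrite XT edges_in_setT cardsT.
rewrite -subTset => /subsetPn[y0 _ y0X].
have [x [u [xX uX xu]]] := connected_boundary conn x0X y0X.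
have lt : (#|edges_in X| < #|edges_in (u |: X)|)%N.
  apply: proper_card; apply/properP; split; first exact/edges_inS/subsetUr.
  exists [set x; u]; rewrite set2_edges_in ?(negPf uX) ?andbF //.
  by rewrite xu !inE eqxx xX orbT.
have := IHn (u |: X); rewrite cardsU1 uX setCU setIC -setDE !inE x0X orbT.
have := cardsD1 u (~: X); rewrite inE uX.
by move: lt Xn; clear; lia.
Qed.

Lemma bicyclic_sparse (G : sgraph) (X : {set G}) :
  bicyclic G -> (#|edges_in X| <= #|X|.+1)%N.
Proof.
case=> conn cardE; have [->|/set0Pn[x0 x0X]] := eqVneq X set0.
  rewrite [edges_in _](_ : _ = set0) ?cards0 //; apply/setP => e; rewrite in_set0.
  by apply/negbTE/negP => /edge_inP[u [v []]]; rewrite inE.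
by have := connected_edges_in conn x0X; rewrite cardE; clear; lia.
Qed.

(** An isolated edge would be the whole graph, which has more edges than vertices. *)
Lemma bicyclic_no_isolated_edge (G : sgraph) :
  bicyclic G -> no_isolated_edge [set: G].
Proof.
case=> conn cardE u v uT vT uv; rewrite ltnNge; apply/negP => le2.
have [du dv] : #|nbh [set: G] u| = 1%N /\ #|nbh [set: G] v| = 1%N.
  have := nbh_gt0 vT uv; have := @nbh_gt0 G setT v u uT; rewrite adj_sym => /(_ uv).
  by move: le2; clear; lia.
have nbrE (s t w : G) : #|nbh [set: G] s| = 1%N -> adj s t -> adj s w -> w = t.
  move=> /eqP/cards1P[c cE] st sw.
  have /set1P -> : t \in [set c] by rewrite -cE !inE.
  by apply/set1P; rewrite -cE !inE.
have GE : [set: G] = [set u; v].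
  apply/eqP; rewrite eq_sym -subTset; apply/subsetP => z _.
  apply: contraT => zuv.
  have [x [y [xuv yuv xy]]] := connected_boundary conn (set21 u v) zuv.
  case/negP: yuv; case/set2P: xuv xy => -> xy.
    by rewrite (nbrE u v y du uv xy) set22.
  by rewrite (nbrE v u y dv _ xy) ?set21 // adj_sym.
have sum2 : (\sum_(z in [set: G]) #|nbh [set: G] z| = 2)%N.
  transitivity (\sum_(z in [set u; v]) #|nbh [set: G] z|)%N; first by rewrite -GE.
  by rewrite big_setU1 ?inE ?adj_neq //= big_set1 du dv.
move: (handshake [set: G]).
by rewrite sum2 edges_in_setT cardE -cardsT GE cards2 adj_neq.
Qed.

(** * The matrix of an oriented graph *)
Section Orientation.
Variables (R : numFieldType) (G : sgraph) (o : edge G -> G * G).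
Hypothesis oP : is_orientation o.

Definition incidence (r : {set G}) (v : G) : R :=
  if insub r is Some e then (v == (o e).2)%:R - (v == (o e).1)%:R else 0.

Lemma incidence_edge (e : edge G) v :
  incidence (val e) v = (v == (o e).2)%:R - (v == (o e).1)%:R.
Proof. by rewrite /incidence valK. Qed.

Lemma edge_setE (r : {set G}) : r \in edge_set G -> exists e : edge G, r = val e.
Proof. by move=> rE; exists (Sub r rE); rewrite SubK. Qed.

Lemma orientation_adj (e : edge G) : adj (o e).1 (o e).2.
Proof. by rewrite -set2_in_edge_set -oP; apply: valP. Qed.

Lemma orientation_neq (e : edge G) :
  (((o e).1 == (o e).2) = false) * (((o e).2 == (o e).1) = false).
Proof. by rewrite [(o e).2 == _]eq_sym (negbTE (adj_neq (orientation_adj e))). Qed.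

Lemma incidence_out r v : r \in edge_set G -> v \notin r -> incidence r v = 0.
Proof.
move=> /edge_setE[e ->]; rewrite incidence_edge oP !inE negb_or.
by move=> /andP[/negbTE -> /negbTE ->]; rewrite subrr.
Qed.

Lemma incidence_in u v : adj u v -> incidence [set u; v] u != 0.
Proof.
rewrite -set2_in_edge_set => /edge_setE[e eE].
have := set21 u v; rewrite eE incidence_edge oP.
move=> /set2P[]->; rewrite eqxx orientation_neq.
  by rewrite sub0r oppr_eq0 oner_neq0.
by rewrite subr0 oner_neq0.
Qed.

Lemma incidence_opp u v : adj u v ->
  incidence [set u; v] u + incidence [set u; v] v = 0.
Proof.
rewrite -set2_in_edge_set => /edge_setE[e eE]; rewrite eE !incidence_edge.
move: eE; rewrite oP => /set2_eq[[-> ->]|[-> ->]]; rewrite !eqxx !orientation_neq.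
  by rewrite sub0r subr0 addNr.
by rewrite sub0r subr0 addrN.
Qed.

Lemma edge_entryE (e y : edge G) :
  edge_entry R o e y = ((o e).2 \in val y)%:R - ((o e).1 \in val y)%:R.
Proof.
rewrite /edge_entry; have [->|ne] := eqVneq y e.
  by rewrite oP set21 set22 subrr.
have [o2|_] := boolP ((o e).2 \in val y); have [o1|_] := boolP ((o e).1 \in val y).
- case/eqP: ne; apply: val_inj; rewrite [in RHS]oP.
  by apply: edge_two_ends o1 o2 (adj_neq (orientation_adj e)); apply: valP.
- by rewrite subr0.
- by rewrite sub0r.
- by rewrite subrr.
Qed.

(** When [y] is [e], the contributions of the two ends of [e] cancel. *)
Lemma col_edge_entry (e y : edge G) :
  col incidence (val y) (val e) = edge_entry R o e y.
Proof.
have delta w : \sum_(v in val y) (v == w)%:R = (w \in val y)%:R :> R.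
  have [wy|wy] := boolP (w \in val y).
    rewrite (bigD1 w) //= eqxx big1 ?addr0 // => v /andP[_ /negbTE ->] //.
  by apply: big1 => v vy; case: eqP vy wy => // -> ->.
rewrite edge_entryE /col sum_ffunE -!delta -sumrB.
by apply: eq_bigr => v _; rewrite ffunE incidence_edge.
Qed.

Lemma pind_le2_pind_admissible :
  pind_le2 incidence [set: G] -> pind_admissible (edge_matrix R o) 2.
Proof.
case=> ys [ysG ys2 nz]; rewrite edges_in_setT in ysG nz.
pose m := #|{: edge G}|.
pose g (i : 'I_m) : {set G} := val (enum_val i).
have g_inj : injective g by move=> i j /val_inj/enum_val_inj.
have gG : g @: 'I_m = edge_set G.
  apply/setP => e; apply/imsetP/idP => [[i _ ->]|/edge_setE[y ->]]; first exact: valP.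
  by exists (enum_rank y); rewrite // /g enum_rankK.
have szys : size ys = m.
  have := per_on_size nz; rewrite size_map => ->.
  by rewrite -gG card_imset // card_ord.
have ysE (j : 'I_m) : exists y : edge G, nth set0 ys j = val y.
  by apply/edge_setE/ysG/mem_nth; rewrite szys.
have [f fP] : exists f : {ffun 'I_m -> 'I_m}, forall j : 'I_m, nth set0 ys j = g (f j).
  have /fin_all_exists[h hP] := ysE.
  by exists [ffun j => enum_rank (h j)] => j; rewrite ffunE /g enum_rankK.
apply/existsP; exists f; apply/andP; split.
  have perE := per_on_permanent g_inj (etrans (size_map _ _) szys).
  rewrite gG in perE; move: nz; rewrite perE.
  congr (permanent _ != 0); apply/matrixP => i j.
  by rewrite !mxE (nth_map set0) ?szys // fP col_edge_entry.
apply/forallP => j; apply: leq_trans (ys2 (g j)).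
rewrite -sum1_count (big_nth set0) big_mkord szys sum1_card.
apply/subset_leq_card/subsetP => i; rewrite !inE => /eqP <-.
by rewrite unfold_in /= fP; apply: eqxx.
Qed.

End Orientation.

(** * Index and choosability *)

Lemma pind_le (R : comNzRingType) m n (A : 'M[R]_(m, n)) k :
  pind_admissible A k -> exists2 k' : nat, pind A = Some k' & (k' <= k)%N.
Proof.
move=> Ak; rewrite /pind; case: pselect => [h|[]]; last by exists k.
by exists (ex_minn h) => //; case: ex_minnP => k' _; apply.
Qed.

Lemma orientation_exists (G : sgraph) :
  exists o : edge G -> G * G, is_orientation o.
Proof.
have oE (e : edge G) : exists c : G * G, val e = [set c.1; c.2].
  by have /edge_setP[u [v [_ ->]]] := valP e; exists (u, v).
by have /fin_all_exists[o oP] := oE; exists o.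
Qed.

Lemma vertex_sum_sub (R : realType) (G : sgraph) (o : edge G -> G * G)
    (f : G + edge G -> R) (e : edge G) : is_orientation o ->
  vertex_sum f (o e).2 - vertex_sum f (o e).1 =
  f (inl (o e).2) - f (inl (o e).1) + \sum_y edge_entry R o e y * f (inr y).
Proof.
move=> oP; rewrite /vertex_sum opprD addrACA; congr (_ + _).
rewrite big_mkcond [X in _ - X]big_mkcond -sumrB; apply: eq_bigr => y _.
rewrite edge_entryE // mulrBl.
by case: ((o e).2 \in _); case: ((o e).1 \in _); rewrite ?mul1r ?mul0r.
Qed.

Lemma pind_choosable (R : realType) (G : sgraph) (o : edge G -> G * G) k :
  is_orientation o -> pind_admissible (edge_matrix R o) k -> choosable R G 1 k.+1.
Proof.
move=> oP /existsP[c /andP[cnz /forallP ck]] L Lv Le.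
pose t (j : 'I_#|{: edge G}|) (l : 'I_k.+1) : R := nth 0 (L (inr (enum_val j))) l.
have t_inj j : injective (t j).
  move=> l l' /eqP; rewrite /t nth_uniq ?Le ?fset_uniq // => /eqP.
  exact: val_inj.
pose fv v : R := nth 0 (L (inl v)) 0.
pose b (i : 'I_#|{: edge G}|) := fv (o (enum_val i)).2 - fv (o (enum_val i)).1.
have [x xP] := nullstellensatz b t_inj cnz ck.
pose f (z : G + edge G) := match z with
  | inl v => fv v | inr e => t (enum_rank e) (x (enum_rank e)) end.
exists f; last first.
  case=> [v|e] /=; first by rewrite /fv; apply: mem_nth; rewrite Lv.
  by rewrite /t enum_rankK; apply: mem_nth; rewrite Le.
have neq (e : edge G) : vertex_sum f (o e).2 != vertex_sum f (o e).1.
  rewrite -subr_eq0 vertex_sum_sub //; have := xP (enum_rank e).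
  rewrite /b enum_rankK; congr (_ + _ != 0).
  rewrite [RHS](reindex_onto enum_val enum_rank) /=; last first.
    by move=> y _; rewrite enum_rankK.
  by apply: eq_big => [j|j _]; rewrite ?enum_valK ?eqxx // mxE enum_rankK.
move=> u v; rewrite -set2_in_edge_set => /edge_setE[e eE].
have := neq e; move: eE; rewrite oP => /set2_eq[[-> ->]|[-> ->]].
  by rewrite eq_sym => /eqP.
by move=> /eqP.
Qed.

Theorem theorem3p11 (R : realType) (n : nat) (B : sgraph)
    (card_B : #|B| = n) (bicyclic_B : bicyclic B) :
  (forall o : edge B -> B * B, is_orientation o ->
     exists2 k : nat, pind (edge_matrix R o) = Some k & (k <= 2)%N)
  /\ choosable R B 1 3.
Proof.
have admissible (o : edge B -> B * B) :
    is_orientation o -> pind_admissible (edge_matrix R o) 2.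
  move=> oP; apply: pind_le2_pind_admissible => //; apply: pind_le2_of_sparse.
  - exact: incidence_out.
  - exact: incidence_in.
  - exact: incidence_opp.
  - by move=> X; apply: bicyclic_sparse.
  - exact: bicyclic_no_isolated_edge.
split=> [o oP|]; first exact/pind_le/admissible.
have [o oP] := orientation_exists B.
exact: pind_choosable oP (admissible o oP).
Qed.
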